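(* Let $n\ge 2$, let $D\subsetneq\mathbb{R}^n$ be a proper subdomain and let $u\in\partial D$ be a $\mathcal{C}^1$-smooth boundary point of $D$. Then $$\lim_{\substack{x,y\to u\\ x,y\in D,\ x\neq y}}\frac{m_D(x,y)}{\psi_D(x,y)}=1 .$$
   Context: A domain is a nonempty open connected set. For a proper subdomain $D\subset\mathbb{R}^n$ and $z\in D$, let $\delta_D(z)=\inf\{|z-\xi|:\xi\in\partial D\}$ be the Euclidean distance from $z$ to $\partial D$, let $d(D)=\operatorname{diam}(D)\in(0,\infty]$ be the Euclidean diameter of $D$ (infinite if $D$ is unbounded), and, when $D$ is bounded, let $\eta_D(z)=\delta_D(z)\,(d(D)-\delta_D(z))$. The metric $m_D$ is $$m_D(x,y)=\inf_{\gamma\in\Gamma_{xy}}\int_\gamma \frac{d(D)}{\eta_D(z)}\,|dz|,$$ where $\Gamma_{xy}$ is the family of all rectifiable paths in $D$ joining $x$ to $y$, and $$\psi_D(x,y)=2\sinh^{-1}\frac{d(D)\,|x-y|}{2\sqrt{\eta_D(x)\,\eta_D(y)}} .$$ If $D$ is unbounded, these expressions are read with $\eta_D(z)/d(D)$ replaced by $\delta_D(z)$; that is, $m_D(x,y)=\inf_{\gamma\in\Gamma_{xy}}\int_\gamma |dz|/\delta_D(z)$ and $\psi_D(x,y)=2\sinh^{-1}\frac{|x-y|}{2\sqrt{\delta_D(x)\delta_D(y)}}$. A point $u\in\partial D$ is a $\mathcal{C}^1$-smooth boundary point if, after a rigid motion of $\mathbb{R}^n$ sending $u$ to $0$, there are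 a neighbourhood $\mathcal{U}$ of $0$ and a $\mathcal{C}^1$ function $\tau$ of $n-1$ real variables with $\tau(0)=0$ and $\nabla\tau(0)=0$ such that $D\cap\mathcal{U}=\{x\in\mathcal{U}:x_1+\tau(x_2,\dots,x_n)>0\}$ and $\partial D\cap\mathcal{U}=\{x\in\mathcal{U}:x_1+\tau(x_2,\dots,x_n)=0\}$. *)

(* Defs.v *)
From mathcomp Require Import all_boot all_order all_algebra.
From mathcomp Require Import all_classical all_reals all_analysis.
Set Implicit Arguments.
Unset Strict Implicit.
Unset Printing Implicit Defensive.
Import Order.TTheory GRing.Theory Num.Theory.
Import numFieldNormedType.Exports.
Local Open Scope classical_set_scope.
Local Open Scope ring_scope.

(* Points of R^n are row vectors. The library norm `|x| on 'rV[R]_n is the sup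
   norm: it induces the usual topology (nbhs, open, continuous, ...), but all
   metric quantities below use the Euclidean norm [enorm]. *)
Definition enorm (R : realType) (n : nat) (x : 'rV[R]_n) : R :=
  Num.sqrt (\sum_(i < n) x 0 i ^+ 2).

Definition sinh (R : realType) (x : R) : R := (expR x - expR (- x)) / 2.

Definition arsinh (R : realType) (y : R) : R := get [set x | sinh x = y].

Definition boundary (T : topologicalType) (A : set T) : set T :=
  closure A `\` interior A.

Definition domain (R : realType) (n : nat) (D : set 'rV[R]_n) : Prop :=
  [/\ D !=set0, open D & connected D].

Definition bdist (R : realType) (n : nat) (D : set 'rV[R]_n) (z : 'rV[R]_n) : R :=
  inf [set enorm (z - xi) | xi in boundary D].

Definition diam (R : realType) (n : nat) (D : set 'rV[R]_n) : \bar R :=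
  ereal_sup [set (enorm (p.1 - p.2))%:E | p in D `*` D].

(* eta_D for bounded D, where d is the diameter of D. *)
Definition eta (R : realType) (n : nat) (D : set 'rV[R]_n) (d : R)
    (z : 'rV[R]_n) : R :=
  bdist D z * (d - bdist D z).

Section paths.
Variables (R : realType) (n : nat).
Implicit Types (a b : R) (g : R -> 'rV[R]_n).

(* Euclidean counterpart of [total_variation]. *)
Definition path_length a b g : \bar R :=
  ereal_sup [set (\sum_(i < size s)
      enorm (g (nth b (a :: s) i.+1) - g (nth b (a :: s) i)))%:E
    | s in itv_partition a b].

(* g restricted to [a, b] is a rectifiable path in D joining x to y. *)
Definition rectifiable_path (D : set 'rV[R]_n) (x y : 'rV[R]_n) a b g : Prop :=
  [/\ a <= b, {within `[a, b], continuous g}, g @` `[a, b] `<=` D,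
      g a = x /\ g b = y & (path_length a b g < +oo)%E].

(* Arc length parametrization: with s(t) the length of g on [a, t], it is the
   unique map g0 on [0, s(b)] such that g = g0 \o s on [a, b]. As s is
   continuous and nondecreasing, the infimum below is the first parameter t with
   s(t) = r. *)
Definition arc_length_param a b g (r : R) : 'rV[R]_n :=
  g (inf [set t | a <= t <= b /\ r <= fine (path_length a t g)]).

(* The integral of rho |dz| along g. *)
Definition line_integral (rho : 'rV[R]_n -> R) a b g : \bar R :=
  (\int[lebesgue_measure]_(r in `[0%R, fine (path_length a b g)])
     (rho (arc_length_param a b g r))%:E)%E.

End paths.

Definition m_density (R : realType) (n : nat) (D : set 'rV[R]_n)
    (z : 'rV[R]_n) : R :=
  if diam D is d%:E then d / eta D d z else (bdist D z)^-1.

Definition m_metric (R : realType) (n : nat) (D : set 'rV[R]_n)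
    (x y : 'rV[R]_n) : \bar R :=
  ereal_inf [set l | exists a b (g : R -> 'rV[R]_n),
    rectifiable_path D x y a b g /\ l = line_integral (m_density D) a b g].

Definition psi (R : realType) (n : nat) (D : set 'rV[R]_n)
    (x y : 'rV[R]_n) : R :=
  if diam D is d%:E then
    2 * arsinh (d * enorm (x - y) / (2 * Num.sqrt (eta D d x * eta D d y)))
  else 2 * arsinh (enorm (x - y) / (2 * Num.sqrt (bdist D x * bdist D y))).

Definition rigid_motion (R : realType) (n : nat)
    (T : 'rV[R]_n -> 'rV[R]_n) : Prop :=
  exists (A : 'M[R]_n) (b : 'rV[R]_n),
    A *m A^T = 1%:M /\ forall x, T x = x *m A + b.

Definition partial (R : realType) (n : nat) (i : 'I_n) (tau : 'rV[R]_n -> R)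
    (v : 'rV[R]_n) : R :=
  'D_(delta_mx 0 i) tau v.

Definition C1_on (R : realType) (n : nat) (V : set 'rV[R]_n)
    (tau : 'rV[R]_n -> R) : Prop :=
  open V /\ forall v, V v ->
    differentiable tau v /\ forall i, {for v, continuous (partial i tau)}.

Definition tail (R : realType) (n : nat) (x : 'rV[R]_n.+1) : 'rV[R]_n :=
  \row_j x 0 (lift ord0 j).

(* tau is only required to be defined (and C^1) on an open set V containing the
   points (x_2, ..., x_n) for x in U; V = setT is allowed. *)
Definition C1_boundary_point (R : realType) (n : nat) (D : set 'rV[R]_n.+1)
    (u : 'rV[R]_n.+1) : Prop :=
  boundary D u /\
  exists (T : 'rV[R]_n.+1 -> 'rV[R]_n.+1) (U : set 'rV[R]_n.+1)
         (V : set 'rV[R]_n) (tau : 'rV[R]_n -> R),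
    [/\ rigid_motion T /\ T u = 0,
        nbhs (0 : 'rV[R]_n.+1) U,
        C1_on V tau /\ U `<=` @tail R n @^-1` V,
        tau 0 = 0 /\ (forall i, partial i tau 0 = 0) &
        T @` D `&` U = [set x | U x /\ 0 < x 0 0 + tau (tail x)] /\
        T @` boundary D `&` U = [set x | U x /\ x 0 0 + tau (tail x) = 0]].

(* Main.v *)
Require Import Defs.
From mathcomp Require Import all_boot all_order all_algebra.
From mathcomp Require Import all_classical all_reals all_analysis measurable_realfun.
From mathcomp Require Import ring lra.
Import Order.TTheory GRing.Theory Num.Theory.
Import numFieldNormedType.Exports.
Local Open Scope classical_set_scope.
Local Open Scope ring_scope.

(** Let rho be the density of m_D. Whether D is bounded or not, psi_D(x,y) is
    2 arsinh(|x - y| sqrt(rho(x) rho(y)) / 2) ([psiE]). For a half-space this is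
    the hyperbolic distance, that is, the path metric of the density itself. The
    theorem says that near a C^1 boundary point the path metric and this formula
    still agree, up to a factor tending to 1; the proof transports everything to
    the half-space.

    The chart F(z) = T z + tau(tail(T z)) e_1 straightens the boundary
    ([C1_boundary_chart]). Since the gradient of tau vanishes at 0, tau is
    e-Lipschitz near 0 ([C1_small_lipschitz]), so that F changes distances by
    factors between 1 - e and 1 + e. Points of the boundary go to height 0, so
    the height of F(z) is comparable to delta_D(z) with the same precision; and
    d/(d - delta_D) tends to 1 at the boundary, so rho(z) times the height of F(z)
    is close to 1. For every K > 1 close to 1 there is thus a neighbourhood of u
    in which all these quantities agree with those of the half-space up to the
    factor K: this is the predicate [chart]. There, psi_D(x,y) is within a factor
    K^2 of the hyperbolic distance h(F x, F y) ([psi_hdist_comparable]), and it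
    remains to compare m_D(x,y) with h(F x, F y).

    Upper bound ([chart_path_upper]). The preimage under F of the hyperbolic
    geodesic from F x to F y is a path in D, provided that the geodesic stays
    in the region covered by the chart; it does, because the square norm along
    a geodesic is a weighted mean of those of its end points
    ([sqnorm_geod]).

    Lower bound ([hdist_chart_lower]). A path from x to y may leave the chart,
    so it is tested against a potential that is defined on all of D:
    Phi(z) = min(h(F x, F z), A) - min(h(F y, F z), B), with A + B = h(F x, F y),
    extended by the constant A - B. The extension is consistent because points
    at a fixed distance from u are at hyperbolic distance at least A from F x
    and B from F y, once x and y are close to u ([hdist_far], [hdist_near]).
    By the triangle inequality the two minima never vary together, so Phi is
    locally as Lipschitz as h itself, while Phi(y) - Phi(x) = h(F x, F y).

    Local estimates along a path are turned into bounds on its line integral by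
    means of step functions of the arc length, one step for each short piece of
    the path ([potential_le_line_integral], [line_integral_le_of_local]). *)

Set Implicit Arguments.
Unset Strict Implicit.
Unset Printing Implicit Defensive.

(** * The Euclidean norm *)
Section euclidean.
Context {R : realType} {n : nat}.
Implicit Types x y z : 'rV[R]_n.

Definition dotr x y : R := \sum_i x 0 i * y 0 i.
Definition sqnorm x : R := dotr x x.

Lemma dotrC x y : dotr x y = dotr y x.
Proof. by apply: eq_bigr => i _; rewrite mulrC. Qed.

Lemma dotrDl x y z : dotr (x + y) z = dotr x z + dotr y z.
Proof. by rewrite /dotr -big_split; apply: eq_bigr => i _; rewrite mxE mulrDl. Qed.

Lemma dotrZl (k : R) x y : dotr (k *: x) y = k * dotr x y.
Proof. by rewrite /dotr big_distrr; apply: eq_bigr => i _; rewrite mxE /= mulrA. Qed.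

Lemma dotrNl x y : dotr (- x) y = - dotr x y.
Proof. by rewrite -scaleN1r dotrZl mulN1r. Qed.

Lemma dotrDr x y z : dotr z (x + y) = dotr z x + dotr z y.
Proof. by rewrite dotrC dotrDl !(dotrC z). Qed.

Lemma dotrZr (k : R) x y : dotr y (k *: x) = k * dotr y x.
Proof. by rewrite dotrC dotrZl dotrC. Qed.

Lemma dotrNr x y : dotr y (- x) = - dotr y x.
Proof. by rewrite dotrC dotrNl dotrC. Qed.

Definition dotrE := (dotrDl, dotrDr, dotrNl, dotrNr, dotrZl, dotrZr).

Lemma dotr_delta x i : dotr x (delta_mx 0 i) = x 0 i.
Proof.
rewrite /dotr (bigD1 i)//= mxE !eqxx mulr1 big1 ?addr0// => j ji.
by rewrite mxE (negbTE ji) andbF mulr0.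
Qed.

Lemma sqnorm_ge0 x : 0 <= sqnorm x.
Proof. by apply: sumr_ge0 => i _; rewrite -expr2 sqr_ge0. Qed.

Lemma enormE x : enorm x = Num.sqrt (sqnorm x).
Proof. by congr Num.sqrt; apply: eq_bigr => i _; rewrite expr2. Qed.

Lemma sqr_enorm x : enorm x ^+ 2 = sqnorm x.
Proof. by rewrite enormE sqr_sqrtr// sqnorm_ge0. Qed.

Lemma enorm_ge0 x : 0 <= enorm x.
Proof. exact: sqrtr_ge0. Qed.

Lemma enormN x : enorm (- x) = enorm x.
Proof. by rewrite !enormE /sqnorm !dotrE opprK. Qed.

Lemma enorm_distC x y : enorm (x - y) = enorm (y - x).
Proof. by rewrite -enormN opprB. Qed.

Lemma enormZ (k : R) x : enorm (k *: x) = `|k| * enorm x.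
Proof. by rewrite !enormE /sqnorm !dotrE mulrA -expr2 sqrtrM ?sqr_ge0// sqrtr_sqr. Qed.

Lemma enorm0 : enorm (0 : 'rV[R]_n) = 0.
Proof. by rewrite -(scale0r 0) enormZ normr0 mul0r. Qed.

Lemma coord_le_enorm x i : `|x 0 i| <= enorm x.
Proof.
rewrite -sqrtr_sqr enormE ler_wsqrtr//.
rewrite /sqnorm /dotr (bigD1 i)//= -expr2 lerDl.
by apply: sumr_ge0 => j _; rewrite -expr2 sqr_ge0.
Qed.

Lemma enorm_eq0 x : enorm x = 0 -> x = 0.
Proof.
move=> x0; apply/rowP => i; rewrite mxE; apply/eqP.
by rewrite -normr_le0 -x0 coord_le_enorm.
Qed.

Lemma enorm_gt0 x : x <> 0 -> 0 < enorm x.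
Proof.
by move=> x0; rewrite lt_neqAle enorm_ge0 andbT; apply/eqP => /esym/enorm_eq0.
Qed.

(** Expanding the nonnegative square of |y|^2 x - (x.y) y gives
    |y|^2 (|x|^2 |y|^2 - (x.y)^2). *)
Lemma cauchy_schwarz x y : dotr x y <= enorm x * enorm y.
Proof.
apply: le_trans (ler_norm _) _.
rewrite -(ler_pXn2r (_ : 0 < 2)%N)// ?nnegrE ?mulr_ge0 ?enorm_ge0//.
rewrite real_normK ?num_real// exprMn !sqr_enorm.
have [y0|y0] := eqVneq (enorm y) 0.
  rewrite (enorm_eq0 y0) -(scale0r 0) /sqnorm !dotrE !mul0r expr0n mulr0.
  exact: lexx.
have := sqnorm_ge0 (sqnorm y *: x - dotr x y *: y).
have -> : sqnorm (sqnorm y *: x - dotr x y *: y) =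
          sqnorm y * (sqnorm x * sqnorm y - dotr x y ^+ 2).
  by rewrite /sqnorm !dotrE (dotrC y x); ring.
rewrite pmulr_rge0 ?subr_ge0//.
by rewrite -sqr_enorm exprn_gt0// lt_neqAle eq_sym y0 enorm_ge0.
Qed.

Lemma enormD x y : enorm (x + y) <= enorm x + enorm y.
Proof.
rewrite -(ler_pXn2r (_ : 0 < 2)%N)// ?nnegrE ?addr_ge0 ?enorm_ge0//.
rewrite sqr_enorm sqrrD !sqr_enorm /sqnorm !dotrE (dotrC y x).
have := cauchy_schwarz x y; lra.
Qed.

Lemma enorm_dist_tri x y z : enorm (x - z) <= enorm (x - y) + enorm (y - z).
Proof. by rewrite -[x - z](subrKA y) enormD. Qed.

Lemma norm_le_enorm x : `|x| <= enorm x.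
Proof.
have -> : `|x| = mx_norm x by [].
rewrite mx_normrE; apply/bigmax_leP; split; first exact: enorm_ge0.
by move=> [i j] _ /=; rewrite ord1 coord_le_enorm.
Qed.

Lemma enorm_le_norm x : enorm x <= n%:R * `|x|.
Proof.
have x0 : 0 <= n%:R * `|x| by rewrite mulr_ge0.
rewrite -(ler_pXn2r (_ : 0 < 2)%N)// ?nnegrE ?enorm_ge0// sqr_enorm.
have le i : x 0 i * x 0 i <= `|x| ^+ 2.
  rewrite -expr2 -real_normK ?num_real// ler_pXn2r// ?nnegrE//.
  have -> : `|x| = mx_norm x by [].
  by rewrite mx_normrE (le_bigmax_cond _ (fun ij => `|x ij.1 ij.2|) (_ : xpredT (0, i))).
apply: (@le_trans _ _ (\sum_(i < n) `|x| ^+ 2)); first exact: ler_sum.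
rewrite sumr_const card_ord -[X in X <= _]mulr_natl exprMn.
apply: ler_wpM2r; first exact: sqr_ge0.
by rewrite -natrX ler_nat -mulnn; case: (n) => // m; rewrite leq_pmulr.
Qed.

(** The topology is that of the sup norm; Euclidean balls give the same
    neighbourhoods. *)
Lemma nbhs_eball x (P : set 'rV[R]_n) :
  nbhs x P <-> exists2 e : R, 0 < e & forall y, enorm (y - x) < e -> P y.
Proof.
split.
  move=> /nbhs_ballP[e /= e0 He]; exists e => // y yx; apply: He => /=.
  rewrite -ball_normE /=.
  by rewrite -normrN opprB (le_lt_trans (norm_le_enorm _)).
move=> [e e0 He]; apply/nbhs_ballP; exists (e / n.+1%:R) => /=.
  by rewrite divr_gt0.
move=> y; rewrite -ball_normE /= => xy; apply: He; rewrite enorm_distC.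
apply: le_lt_trans (enorm_le_norm _) _.
move: xy; rewrite ltr_pdivlMr ?ltr0Sn//; apply: le_lt_trans.
by rewrite mulrC ler_wpM2l// ler_nat.
Qed.

End euclidean.

Section euclideanS.
Context {R : realType} {n : nat}.
Implicit Types x y : 'rV[R]_n.+1.

Lemma dotr_tail x y : dotr x y = x 0 0 * y 0 0 + dotr (tail x) (tail y).
Proof.
by rewrite /dotr big_ord_recl; congr (_ + _); apply: eq_bigr => i _; rewrite !mxE.
Qed.

Lemma sqnorm_tail x : sqnorm x = x 0 0 ^+ 2 + sqnorm (tail x).
Proof. by rewrite /sqnorm dotr_tail expr2. Qed.

Lemma enorm_tail_le x : enorm (tail x) <= enorm x.
Proof. by rewrite !enormE ler_wsqrtr// sqnorm_tail lerDr sqr_ge0. Qed.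

Lemma tailD x y : tail (x + y) = tail x + tail y.
Proof. by apply/rowP => i; rewrite !mxE. Qed.

Lemma tailZ (k : R) x : tail (k *: x) = k *: tail x.
Proof. by apply/rowP => i; rewrite !mxE. Qed.

Lemma tailB x y : tail (x - y) = tail x - tail y.
Proof. by apply/rowP => i; rewrite !mxE. Qed.

Lemma tail0 : tail (0 : 'rV[R]_n.+1) = 0.
Proof. by apply/rowP => i; rewrite !mxE. Qed.

Lemma tail_delta : tail (delta_mx 0 0 : 'rV[R]_n.+1) = 0.
Proof. by apply/rowP => i; rewrite !mxE. Qed.

Lemma headB x y : (x - y) 0 0 = x 0 0 - y 0 0.
Proof. by rewrite !mxE. Qed.

Lemma head_le_enorm x : x 0 0 <= enorm x.
Proof. exact: le_trans (ler_norm _) (coord_le_enorm _ _). Qed.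

Lemma eq_head_tail x y : x 0 0 = y 0 0 -> tail x = tail y -> x = y.
Proof.
move=> h t; apply/rowP => i; case: (unliftP ord0 i) => [j ->|-> //].
by move/rowP/(_ j): t; rewrite !mxE.
Qed.
End euclideanS.

Lemma within_continuous_eball (R : realType) (n : nat) (g : R -> 'rV[R]_n.+1)
    (a b : R) :
  {within `[a, b], continuous g} <->
  forall t, a <= t <= b -> forall e : R, 0 < e -> exists2 d : R, 0 < d &
    forall s, a <= s <= b -> t - d < s -> s < t + d -> enorm (g s - g t) < e.
Proof.
split.
  move=> /subspace_continuousP gc t tab e e0.
  have tI : `[a, b]%classic t by rewrite /= in_itv.
  have /(_ (fun z => enorm (z - g t) < e)) := gc t tI.
  rewrite /= /nbhs /= => /(_ _); case.
    by apply/nbhs_eball; exists e.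
  move=> d /= d0 H; exists d => // s sab ts st; apply: H.
    by rewrite /= ltr_distlC; lra.
  by rewrite /= in_itv.
move=> H; apply/subspace_continuousP => t; rewrite /= in_itv /= => tab P.
move=> /nbhs_eball[e e0 eP]; have [d d0 dH] := H t tab e e0.
exists d => //= s /=; rewrite ltr_distlC => /andP[ts st].
by rewrite in_itv /= => sab; apply: eP; apply: dH => //; lra.
Qed.

(** * Arc length *)

Section arc_length.
Context {R : realType} {n : nat}.
Implicit Types (g : R -> 'rV[R]_n) (s : seq R).

Fixpoint polygon_length g (a : R) s : R :=
  if s is x :: s' then enorm (g x - g a) + polygon_length g x s' else 0.

(** The sums in the definition of the length of a path, in a form suited to
    induction on the partition. *)
Lemma polygon_lengthE g (a b : R) s :
  \sum_(i < size s) enorm (g (nth b (a :: s) i.+1) - g (nth b (a :: s) i))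
  = polygon_length g a s.
Proof.
elim: s a => [a|x s IH a]; first by rewrite big_ord0.
by rewrite big_ord_recl /= -IH.
Qed.

Lemma polygon_length_ge0 g a s : 0 <= polygon_length g a s.
Proof. by elim: s a => //= x s IH a; rewrite addr_ge0// enorm_ge0. Qed.

Lemma polygon_length_cat g a s s' :
  polygon_length g a (s ++ s') =
  polygon_length g a s + polygon_length g (last a s) s'.
Proof. by elim: s a => [a|x s IH a] /=; rewrite ?add0r// IH addrA. Qed.

Lemma path_lengthE (a b : R) g : path_length a b g =
  ereal_sup [set (polygon_length g a s)%:E | s in itv_partition a b].
Proof.
rewrite /path_length; congr (ereal_sup (image _ _)).
by apply/funext => s; rewrite polygon_lengthE.
Qed.

Lemma polygon_le_path_length (a b : R) g s : itv_partition a b s ->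
  ((polygon_length g a s)%:E <= path_length a b g)%E.
Proof. by move=> abs; rewrite path_lengthE; apply: ereal_sup_ubound; exists s. Qed.

Lemma path_length_ge0 (a b : R) g : a <= b -> (0 <= path_length a b g)%E.
Proof.
rewrite le_eqVlt => /predU1P[->|ab].
  exact: (@polygon_le_path_length b b g [::]).
apply: le_trans (polygon_le_path_length g (itv_partition1 ab)).
by rewrite lee_fin polygon_length_ge0.
Qed.

(** An inscribed polygon of [a, c] is prolonged by the chord from c to b. *)
Lemma path_length_chord (a c b : R) g : a <= c -> c <= b ->
  (path_length a c g + (enorm (g b - g c))%:E <= path_length a b g)%E.
Proof.
move=> ac; rewrite le_eqVlt => /predU1P[<-|cb].
  by rewrite subrr enorm0 adde0.
rewrite -leeBrDr// [leLHS]path_lengthE; apply: ge_ereal_sup => _ [s acs <-].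
rewrite leeBrDr// -EFinD.
have -> : polygon_length g a s + enorm (g b - g c) = polygon_length g a (s ++ [:: b]).
  by rewrite polygon_length_cat /= (eqP (proj2 acs)) addr0.
exact/polygon_le_path_length/(itv_partition_cat acs)/itv_partition1.
Qed.

Definition arc_length g (a t : R) : R := fine (path_length a t g).

Lemma path_length_fin g (a t b : R) : a <= t -> t <= b ->
  (path_length a b g < +oo)%E -> path_length a t g \is a fin_num.
Proof.
move=> at_ tb fin; rewrite ge0_fin_numE ?path_length_ge0//.
apply: le_lt_trans fin; apply: le_trans (path_length_chord g at_ tb).
by rewrite leeDl// lee_fin enorm_ge0.
Qed.

Lemma arc_length_chord g (a s t b : R) : (path_length a b g < +oo)%E ->
  a <= s -> s <= t -> t <= b ->
  arc_length g a s + enorm (g t - g s) <= arc_length g a t.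
Proof.
move=> fin as_ st tb.
rewrite -lee_fin EFinD !fineK; first exact: path_length_chord.
- exact: path_length_fin (le_trans as_ st) tb fin.
- exact: path_length_fin as_ (le_trans st tb) fin.
Qed.

Lemma arc_length_mono g (a s t b : R) : (path_length a b g < +oo)%E ->
  a <= s -> s <= t -> t <= b -> arc_length g a s <= arc_length g a t.
Proof.
move=> fin as_ st tb; apply: le_trans (arc_length_chord fin as_ st tb).
by rewrite lerDl enorm_ge0.
Qed.

Lemma path_length_refl g (a : R) : path_length a a g = 0%E.
Proof.
rewrite path_lengthE.
suff -> : [set (polygon_length g a s)%:E | s in itv_partition a a] = [set 0%E].
  by rewrite ereal_sup1.
apply/seteqP; split => [_ [s /itv_partitionxx -> <-]//|_ ->].
by exists [::].
Qed.

Lemma arc_length_start g (a : R) : arc_length g a a = 0.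
Proof. by rewrite /arc_length path_length_refl. Qed.

(** The parameters before s have arc length less than r, while t has arc length
    at least r: this traps between s and t the infimum that defines the
    parametrization at r. *)
Lemma arc_length_param_between g (a s t b r : R) : (path_length a b g < +oo)%E ->
  a <= s -> s <= t -> t <= b -> arc_length g a s < r -> r <= arc_length g a t ->
  exists2 t', s <= t' <= t & arc_length_param a b g r = g t'.
Proof.
move=> fin as_ st tb sr rt.
rewrite /arc_length_param; set E := [set _ | _]; exists (inf E) => //.
have Et : E t by split => //; rewrite (le_trans as_ st).
apply/andP; split.
  apply: lb_le_inf; [by exists t | move=> t' [/andP[at' t'b] rt']].
  rewrite leNgt; apply/negP => t's.
  have := arc_length_mono fin at' (ltW t's) (le_trans st tb).
  by rewrite leNgt (lt_le_trans sr rt').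
by apply: ge_inf => //; exists a => t' [/andP[]].
Qed.

Lemma arc_length_param0 g (a b : R) : a <= b -> arc_length_param a b g 0 = g a.
Proof.
move=> ab; rewrite /arc_length_param; set E := [set _ | _].
congr g; apply/eqP; rewrite eq_le.
have Ea : E a.
  split; first by rewrite lexx.
  by rewrite -[leLHS](arc_length_start g a).
apply/andP; split.
  by apply: ge_inf => //; exists a => t' [/andP[]].
by apply: lb_le_inf; [exists a | move=> t [/andP[]]].
Qed.

(** Triangle inequality: the vertex c can be inserted into an inscribed
    polygon, which is then cut there. *)
Lemma split_partition g (a c b : R) s :
  a < c -> c < b -> itv_partition a b s ->
  exists s1 s2, [/\ itv_partition a c s1, itv_partition c b s2 &
    polygon_length g a s <= polygon_length g a s1 + polygon_length g c s2].
Proof.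
move=> + cb; elim: s a => [a ac [_ /= /eqP]|x s IH a ac [/= /andP[ax xs] lb]].
  by move=> eab; move: ac; rewrite eab => /(lt_trans cb); rewrite ltxx.
have xbs : itv_partition x b s by split.
case: (ltgtP x c) => [xc|cx|xc].
- have [s1 [s2 [p1 p2 le12]]] := IH x xc xbs.
  exists (x :: s1), s2; split => //=; last by rewrite -addrA lerD2l.
  by case: p1 => p1 l1; split => //=; rewrite ax.
- exists [:: c], (x :: s); split; first exact: itv_partition1.
    by split => //=; rewrite cx.
  by rewrite /= addr0 addrA lerD2r addrC enorm_dist_tri.
- exists [:: c], s; rewrite -xc; split; [exact: itv_partition1| by []|].
  by rewrite /= addr0.
Qed.

Lemma polygon_length_lipschitz g (L s t : R) l :
  (forall x y, s <= x -> x <= y -> y <= t -> enorm (g y - g x) <= L * (y - x)) ->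
  itv_partition s t l -> polygon_length g s l <= L * (t - s).
Proof.
elim: l s => [s _ /itv_partition_nil ->|x l IH s lip p] /=; first by rewrite subrr mulr0.
have sx : s <= x by case: p => /= /andP[/ltW].
have xt : x <= t by apply: itv_partition_le (itv_partition_cons p).
have -> : L * (t - s) = L * (x - s) + L * (t - x) by ring.
apply: lerD; first exact: lip.
apply: IH (itv_partition_cons p) => y z xy; apply: lip; exact: le_trans xy.
Qed.

Lemma path_length_lipschitz g (L a s t : R) :
  a <= s -> s <= t ->
  (forall x y, s <= x -> x <= y -> y <= t -> enorm (g y - g x) <= L * (y - x)) ->
  (path_length a t g <= path_length a s g + (L * (t - s))%:E)%E.
Proof.
rewrite le_eqVlt => /predU1P[<-|as_].
  move=> at_ lip; apply: (@le_trans _ _ (L * (t - a))%:E).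
    rewrite path_lengthE; apply: ge_ereal_sup => _ [l pl <-].
    by rewrite lee_fin polygon_length_lipschitz.
  by rewrite leeDr// path_length_ge0.
rewrite le_eqVlt => /predU1P[<- _|st lip].
  by rewrite subrr mulr0 adde0.
rewrite path_lengthE; apply: ge_ereal_sup => _ [l pl <-].
have [s1 [s2 [p1 p2 le12]]] := split_partition g as_ st pl.
apply: (@le_trans _ _ (polygon_length g a s1 + polygon_length g s s2)%:E).
  by rewrite lee_fin.
rewrite EFinD; apply: leeD; first exact: polygon_le_path_length.
by rewrite lee_fin polygon_length_lipschitz.
Qed.

End arc_length.

(** * Line integrals: from local to global estimates *)

(** The points t such that Q a t holds have a supremum, and the local hypothesis
    at that point allows one more step. *)
Lemma local_to_global (R : realType) (a b : R) (Q : R -> R -> Prop) :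
  a <= b ->
  (forall x y z, a <= x -> x <= y -> y <= z -> z <= b ->
     Q x y -> Q y z -> Q x z) ->
  (forall t, a <= t <= b -> exists2 e : R, 0 < e &
     forall x y,
     a <= x -> x <= y -> y <= b -> t - e < x -> y < t + e -> Q x y) ->
  Q a b.
Proof.
move=> ab trQ locQ.
pose S := [set t | a <= t <= b /\ Q a t].
have Sa : S a.
  split; first by rewrite lexx.
  have [|e e0 Qe] := locQ a; first by rewrite lexx.
  by apply: Qe => //; lra.
have Sb : has_sup S by split; [exists a | exists b => t [/andP[]]].
set c := sup S.
have ac : a <= c by apply: ub_le_sup => //; case: Sb.
have cb : c <= b by apply: ge_sup; [exists a | move=> t [/andP[]]].
have [|e e0 Qe] := locQ c; first by rewrite ac.
have [t [/andP[at_ tb] Qt] ct] := sup_adherent e0 Sb.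
have tc : t <= c by apply: ub_le_sup; [case: Sb | split => //; rewrite at_].
pose y := Num.min b (c + e / 2).
have yb : y <= b by rewrite /y ge_min lexx.
have cy : c <= y by rewrite /y le_min cb; lra.
have ye : y < c + e by rewrite /y gt_min; apply/orP; right; lra.
have Qy : Q a y.
  have ty : t <= y := le_trans tc cy.
  by apply: (trQ a t y) => //; exact: Qe.
have yc : y <= c.
  by apply: ub_le_sup; [case: Sb | split => //; rewrite yb (le_trans ac cy)].
have -> // : b = y.
by move: yc; rewrite /y minEle; case: ifP => // _; lra.
Qed.

(** The integral of a nonnegative function is the supremum over the simple
    functions below it, and g has more of them than f. *)
Lemma ge0_le_integralT d (T : measurableType d) (R : realType)
    (mu : {measure set T -> \bar R}) (f g : T -> \bar R) :
  (forall x, 0 <= f x)%E -> (forall x, f x <= g x)%E ->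
  (\int[mu]_x f x <= \int[mu]_x g x)%E.
Proof.
move=> f0 fg; have g0 x : (0 <= g x)%E by apply: le_trans (fg x).
rewrite !ge0_integralTE//; apply: le_ereal_sup => _ [h /= hf <-].
by exists h => //= x; apply: le_trans (fg x).
Qed.

Section line_integral_bounds.
Context {R : realType} {n : nat}.
Implicit Types (g : R -> 'rV[R]_n) (rho : 'rV[R]_n -> R) (f : R -> \bar R).
Notation mu := (@lebesgue_measure R).

Definition supported (x y : R) f :=
  [/\ measurable_fun setT f, (forall r, 0 <= f r)%E &
      forall r, ~ (x < r <= y) -> f r = 0%E].

Lemma supportedD (x y z : R) f1 f2 : x <= y -> y <= z ->
  supported x y f1 -> supported y z f2 ->
  let f r := (f1 r + f2 r)%E in
  [/\ supported x z f,
      forall r, x < r <= y -> f r = f1 r,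
      forall r, y < r <= z -> f r = f2 r &
      (\int[mu]_r f r = \int[mu]_r f1 r + \int[mu]_r f2 r)%E].
Proof.
move=> xy yz [m1 p1 z1] [m2 p2 z2] f; split; first split.
- exact: emeasurable_funD.
- by move=> r; rewrite adde_ge0.
- move=> r h; rewrite /f z1 ?z2 ?adde0// => /andP[h1 h2]; apply: h.
    by rewrite (le_lt_trans xy h1).
  by rewrite h1 (le_trans h2 yz).
- by move=> r /andP[_ ry]; rewrite /f z2 ?adde0// => /andP[]; rewrite ltNge ry.
- by move=> r /andP[yr _]; rewrite /f z1 ?add0e// => /andP[_]; rewrite leNgt yr.
- by rewrite ge0_integralD.
Qed.

Definition bar (c x y : R) : R -> \bar R := fun r => (c * \1_(`]x, y]%classic) r)%:E.

Lemma barE (c x y r : R) : x < r <= y -> bar c x y r = c%:E.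
Proof. by move=> h; rewrite /bar indicE mem_set ?mulr1//= in_itv. Qed.

Lemma supported_bar (c x y : R) : 0 <= c -> supported x y (bar c x y).
Proof.
move=> c0; split.
- by apply/measurable_EFinP; apply: measurable_funM => //; exact: measurable_indic.
- by move=> r; rewrite lee_fin mulr_ge0.
- by move=> r h; rewrite /bar indicE memNset ?mulr0//= in_itv.
Qed.

Lemma integral_bar (c x y : R) : 0 <= c -> x <= y ->
  (\int[mu]_r bar c x y r = (c * (y - x))%:E)%E.
Proof.
move=> c0 xy; rewrite /bar; under eq_integral do rewrite EFinM.
rewrite ge0_integralZl//; last first.
  by apply/measurable_EFinP; exact: measurable_indic.
rewrite integral_indic// setIT.
rewrite /= lebesgue_measure_itv /= lte_fin EFinM.
case: ltP => // yx; suff -> : y - x = 0 by [].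
by apply/eqP; rewrite subr_eq0 eq_le xy yx.
Qed.

(** Along each short piece of the path, the bar of height c over the
    corresponding interval of arc lengths lies below the density, and its area is
    at least c times the chord of that piece. *)
Lemma potential_le_line_integral rho (a b : R) g (v : R -> R) :
  a <= b -> (path_length a b g < +oo)%E ->
  (forall t, a <= t <= b -> 0 <= rho (g t)) ->
  (forall t, a <= t <= b -> exists2 e : R, 0 < e & exists2 c : R, 0 <= c &
    forall x y, a <= x -> x <= y -> y <= b -> t - e < x -> y < t + e ->
      c <= rho (g x) /\ v y - v x <= c * enorm (g y - g x)) ->
  ((v b - v a)%:E <= line_integral rho a b g)%E.
Proof.
move=> ab fin rho0 loc.
pose s := arc_length g a; pose p := arc_length_param a b g.
pose Q x y := exists f, [/\ supported (s x) (s y) f,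
  forall r, s x < r <= s y -> (f r <= (rho (p r))%:E)%E &
  ((v y - v x)%:E <= \int[mu]_r f r)%E].
have smono x y : a <= x -> x <= y -> y <= b -> s x <= s y.
  by move=> ax xy yb; exact: arc_length_mono fin ax xy yb.
have : Q a b.
  apply: local_to_global ab _ _.
    move=> x y z ax xy yz zb [f1 [s1 l1 i1]] [f2 [s2 l2 i2]].
    have sxy : s x <= s y by apply: smono => //; exact: le_trans yz zb.
    have syz : s y <= s z by apply: smono => //; exact: le_trans ax xy.
    have [s12 E1 E2 I12] := supportedD sxy syz s1 s2.
    exists (fun r => f1 r + f2 r)%E; split => //.
      move=> r /andP[h1 h2]; case: (leP r (s y)) => h3.
        by rewrite E1 ?h1//; apply: l1; rewrite h1.
      by rewrite E2 ?h3//; apply: l2; rewrite h3.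
    have -> : v z - v x = (v y - v x) + (v z - v y) by ring.
    by rewrite I12 EFinD leeD.
  move=> t tab; have [e e0 [c c0 H]] := loc t tab.
  exists e => // x y ax xy yb tx yt.
  have sxy := smono x y ax xy yb.
  exists (bar c (s x) (s y)); split; first exact: supported_bar.
    move=> r h; rewrite barE// lee_fin; move/andP: h => [h1 h2].
    rewrite /p.
    have [t' /andP[xt' t'y] ->] := arc_length_param_between fin ax xy yb h1 h2.
    by case: (H t' y (le_trans ax xt') t'y yb) => //; exact: lt_le_trans xt'.
  rewrite integral_bar// lee_fin; case: (H x y ax xy yb tx yt) => _ h.
  apply: le_trans h _; rewrite ler_wpM2l// lerBrDl.
  exact: arc_length_chord fin ax xy yb.
move=> [f [[mf f0 fz] fl fi]]; apply: le_trans fi _.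
have s0 : s a = 0 by exact: arc_length_start.
rewrite /line_integral [leRHS]integral_mkcond; apply: ge0_le_integralT => // r.
rewrite /patch; case: ifPn => [|/negP h]; last first.
  rewrite fz// s0 => /andP[h1 h2]; apply: h; rewrite inE/= in_itv /=.
  by rewrite (ltW h1).
rewrite inE /= in_itv /= => /andP[].
(* the arc length 0 belongs to no bar *)
rewrite le_eqVlt => /predU1P[<- _|r0 rs]; last by apply: fl; rewrite s0 r0.
rewrite fz ?s0 ?ltxx// lee_fin arc_length_param0// rho0//.
by rewrite lexx.
Qed.

(** The dual of [potential_le_line_integral]: the bars now lie above the density,
    and the Lipschitz bounds limit their widths. *)
Lemma line_integral_le_of_local rho (K a b : R) g :
  a <= b -> 0 <= K -> (forall t, a <= t <= b -> 0 <= rho (g t)) ->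
  (forall t, a <= t <= b -> exists2 e : R, 0 < e &
    exists c L : R, [/\ 0 <= c, 0 <= L, c * L <= K &
    forall x y, a <= x -> x <= y -> y <= b -> t - e < x -> y < t + e ->
      rho (g x) <= c /\ enorm (g y - g x) <= L * (y - x)]) ->
  (path_length a b g < +oo)%E /\
  (line_integral rho a b g <= (K * (b - a))%:E)%E.
Proof.
move=> ab K0 rho0 loc.
have step t x y (e L : R) : a <= x -> x <= y -> y <= b -> t - e < x -> y < t + e ->
    (forall z w, a <= z -> z <= w -> w <= b -> t - e < z -> w < t + e ->
      enorm (g w - g z) <= L * (w - z)) ->
    (path_length a y g <= path_length a x g + (L * (y - x))%:E)%E.
  move=> ax xy yb tx yt H; apply: path_length_lipschitz => // z w xz zw wy.
  apply: H => //; [exact: le_trans xz|exact: le_trans yb|exact: lt_le_trans xz|].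
  exact: le_lt_trans yt.
have fin : (path_length a b g < +oo)%E.
  pose Q x y := (path_length a x g < +oo -> path_length a y g < +oo)%E.
  suff /(_ _) : Q a b.
    by apply; rewrite path_length_refl ltry.
  apply: local_to_global ab _ _; first by move=> x y z _ _ _ _ h1 h2 /h1/h2.
  move=> t tab; have [e e0 [c [L [c0 L0 cL H]]]] := loc t tab.
  exists e => // x y ax xy yb tx yt finx.
  apply: le_lt_trans (step t x y e L ax xy yb tx yt _) _; last first.
    by rewrite lte_add_pinfty// ltry.
  by move=> z w az zw wb tz wt; case: (H z w az zw wb tz wt).
split => //.
pose s := arc_length g a; pose p := arc_length_param a b g.
pose Q x y := exists f, [/\ supported (s x) (s y) f,
  forall r, s x < r <= s y -> ((rho (p r))%:E <= f r)%E &
  (\int[mu]_r f r <= (K * (y - x))%:E)%E].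
have smono x y : a <= x -> x <= y -> y <= b -> s x <= s y.
  by move=> ax xy yb; exact: arc_length_mono fin ax xy yb.
have : Q a b.
  apply: local_to_global ab _ _.
    move=> x y z ax xy yz zb [f1 [s1 l1 i1]] [f2 [s2 l2 i2]].
    have sxy : s x <= s y by apply: smono => //; exact: le_trans yz zb.
    have syz : s y <= s z by apply: smono => //; exact: le_trans ax xy.
    have [s12 E1 E2 I12] := supportedD sxy syz s1 s2.
    exists (fun r => f1 r + f2 r)%E; split => //.
      move=> r /andP[h1 h2]; case: (leP r (s y)) => h3.
        by rewrite E1 ?h1//; apply: l1; rewrite h1.
      by rewrite E2 ?h3//; apply: l2; rewrite h3.
    have -> : K * (z - x) = K * (y - x) + K * (z - y) by ring.
    by rewrite I12 EFinD leeD.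
  move=> t tab; have [e e0 [c [L [c0 L0 cL H]]]] := loc t tab.
  exists e => // x y ax xy yb tx yt.
  have sxy := smono x y ax xy yb.
  exists (bar c (s x) (s y)); split; first exact: supported_bar.
    move=> r h; rewrite barE// lee_fin; move/andP: h => [h1 h2].
    rewrite /p.
    have [t' /andP[xt' t'y] ->] := arc_length_param_between fin ax xy yb h1 h2.
    by case: (H t' y (le_trans ax xt') t'y yb) => //; exact: lt_le_trans xt'.
  rewrite integral_bar// lee_fin.
  apply: (@le_trans _ _ (c * (L * (y - x)))).
    rewrite ler_wpM2l// lerBlDl -lee_fin EFinD !fineK.
    + apply: (step t x y e L) => // z w az zw wb tz wt.
      by case: (H z w az zw wb tz wt).
    + exact: path_length_fin ax (le_trans xy yb) fin.
    + exact: path_length_fin (le_trans ax xy) yb fin.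
  by rewrite mulrA ler_wpM2r// subr_ge0.
move=> [f [[mf f0 fz] fl fi]].
have s0 : s a = 0 by exact: arc_length_start.
(* the bars miss the arc length 0, a null set on which rho (g a) is added *)
pose f' r := (f r + (rho (g a) * \1_[set 0] r)%:E)%E.
have m1 : measurable_fun setT (fun r : R => (rho (g a) * \1_[set 0] r)%:E).
  by apply/measurable_EFinP; apply: measurable_funM => //; exact: measurable_indic.
have rhoa : 0 <= rho (g a) by rewrite rho0// lexx.
apply: (@le_trans _ _ (\int[mu]_r f' r)%E); last first.
  rewrite ge0_integralD//; last by move=> r _; rewrite lee_fin mulr_ge0.
  suff -> : (\int[mu]_r (rho (g a) * \1_[set 0%R] r)%:E = 0)%E by rewrite adde0.
  under eq_integral do rewrite EFinM.
  rewrite ge0_integralZl//; last first.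
    by apply/measurable_EFinP; exact: measurable_indic.
  by rewrite integral_indic// setIT /= lebesgue_measure_set1 mule0.
rewrite /line_integral [leLHS]integral_mkcond; apply: ge0_le_integralT => r.
  rewrite /patch; case: ifPn => // /set_mem/=; rewrite in_itv /= lee_fin => /andP[].
  rewrite le_eqVlt => /predU1P[<- _|r0 rs]; first by rewrite arc_length_param0.
  rewrite -s0 in r0.
  have [t' h ->] := arc_length_param_between fin (lexx a) ab (lexx b) r0 rs.
  exact: rho0.
rewrite /f' /patch; case: ifPn => [/set_mem/=|_]; last first.
  by rewrite adde_ge0// lee_fin mulr_ge0.
rewrite in_itv /= => /andP[].
rewrite le_eqVlt => /predU1P[<- _|r0 rs].
  by rewrite arc_length_param0// indicE mem_set// mulr1 leeDr.
apply: le_trans (fl r _) _; first by rewrite s0 r0.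
by rewrite leeDl// lee_fin mulr_ge0.
Qed.

End line_integral_bounds.

(** * Hyperbolic functions *)

Section hyperbolic_functions.
Context {R : realType}.
Implicit Types x y k : R.

Definition cosh x : R := (expR x + expR (- x)) / 2.

Lemma coshD x y : cosh (x + y) = cosh x * cosh y + sinh x * sinh y.
Proof. by rewrite /cosh /sinh opprD !expRD; field. Qed.

Lemma cosh_sqr x : cosh x ^+ 2 = 1 + sinh x ^+ 2.
Proof.
rewrite /cosh /sinh.
have := expRxMexpNx_1 x; move: (expR x) (expR (- x)) => a b ab.
apply/eqP; rewrite -subr_eq0.
have -> : ((a + b) / 2) ^+ 2 - (1 + ((a - b) / 2) ^+ 2) = a * b - 1 by field.
by rewrite ab subrr.
Qed.

Lemma cosh_double x : cosh (2 * x) = 1 + 2 * sinh x ^+ 2.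
Proof. by rewrite mulr2n mulrDl !mul1r coshD -!expr2 cosh_sqr; ring. Qed.

Lemma sinh0 : sinh (0 : R) = 0.
Proof. by rewrite /sinh oppr0 subrr mul0r. Qed.

Lemma cosh_ge1 x : 1 <= cosh x.
Proof.
rewrite /cosh; have := expRxMexpNx_1 x; have := expR_gt0 x.
move: (expR x) (expR (- x)) => a b a0 ab.
have := sqr_ge0 (a - b); nra.
Qed.

Lemma cosh_gt0 x : 0 < cosh x.
Proof. exact: lt_le_trans (cosh_ge1 x). Qed.

Lemma ltr_sinh : {mono (@sinh R) : x y / x < y}.
Proof.
apply: leW_mono; apply: le_mono => x y xy.
have := xy; rewrite -ltr_expR => h1.
have : expR (- y) < expR (- x) by rewrite ltr_expR ltrN2.
by rewrite /sinh; lra.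
Qed.

Lemma ler_sinh : {mono (@sinh R) : x y / x <= y}.
Proof. by move=> x y; rewrite leNgt ltr_sinh -leNgt. Qed.

Lemma sinh_inj : injective (@sinh R).
Proof.
move=> x y xy; apply/eqP.
by rewrite eq_le -[x <= y]ler_sinh -[y <= x]ler_sinh xy lexx.
Qed.

Lemma sinh_ge0 x : 0 <= x -> 0 <= sinh x.
Proof. by rewrite -{2}sinh0 ler_sinh. Qed.

Lemma sinh_gt0 x : 0 < x -> 0 < sinh x.
Proof. by rewrite -{2}sinh0 ltr_sinh. Qed.

Lemma ltr_cosh x y : 0 <= x -> x < y -> cosh x < cosh y.
Proof.
move=> x0 xy; rewrite -(ltr_pXn2r (_ : 0 < 2)%N)// ?nnegrE ?(ltW (cosh_gt0 _))//.
rewrite !cosh_sqr ltrD2l ltr_pXn2r// ?nnegrE ?sinh_ge0 ?ltr_sinh//.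
exact: le_trans (ltW xy).
Qed.

Lemma cosh_le_inv x y : 0 <= y -> cosh x <= cosh y -> x <= y.
Proof.
move=> y0; rewrite leNgt => h; rewrite leNgt; apply: contra h; exact: ltr_cosh.
Qed.

Lemma ler_cosh x y : 0 <= x -> x <= y -> cosh x <= cosh y.
Proof. by move=> x0; rewrite le_eqVlt => /predU1P[->//|/ltr_cosh h]; rewrite ltW ?h. Qed.

Lemma arsinhK : cancel (@arsinh R) (@sinh R).
Proof.
move=> y; rewrite /arsinh.
apply: (@getPex _ [set x | sinh x = y]).
(* the usual logarithmic formula for the inverse *)
exists (ln (y + Num.sqrt (y ^+ 2 + 1))) => /=.
set s := Num.sqrt _.
have s2 : s ^+ 2 = y ^+ 2 + 1 by rewrite sqr_sqrtr// addr_ge0// sqr_ge0.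
have s0 : 0 <= s by exact: sqrtr_ge0.
have ys : 0 < y + s by nra.
rewrite /sinh expRN lnK ?posrE//.
have -> : (y + s)^-1 = s - y.
  by apply: (mulfI (lt0r_neq0 ys)); rewrite divff ?lt0r_neq0//; lra.
by field.
Qed.

Lemma sinhK : cancel (@sinh R) (@arsinh R).
Proof. by move=> x; apply: sinh_inj; rewrite arsinhK. Qed.

Lemma ler_arsinh : {mono (@arsinh R) : x y / x <= y}.
Proof. by move=> x y; rewrite -ler_sinh !arsinhK. Qed.

Lemma arsinh0 : arsinh (0 : R) = 0.
Proof. by rewrite -{1}sinh0 sinhK. Qed.

Lemma arsinh_ge0 x : 0 <= x -> 0 <= arsinh x.
Proof. by rewrite -{2}arsinh0 ler_arsinh. Qed.

Lemma arsinh_gt0 x : 0 < x -> 0 < arsinh x.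
Proof. by rewrite -{2}arsinh0 !ltNge ler_arsinh. Qed.

Lemma is_derive_sinh_scaled k x :
  is_derive x 1 (fun t => sinh (k * t)) (k * cosh (k * x)).
Proof.
rewrite /sinh; apply: is_derive_eq; rewrite /cosh /GRing.scale /=.
by field.
Qed.

(** The derivative of sinh(k x) - k sinh(x) is k (cosh(k x) - cosh(x)). *)
Lemma sinh_scale_ge k x : 1 <= k -> 0 <= x -> k * sinh x <= sinh (k * x).
Proof.
move=> k1 x0.
pose f t := sinh (k * t) - k * sinh (1 * t).
pose df t := k * cosh (k * t) - k * (1 * cosh (1 * t)).
have dF (t : R) : is_derive t 1 f (df t).
  rewrite /f /df; apply: is_deriveB; first exact: is_derive_sinh_scaled.
  by apply: is_deriveZ; exact: is_derive_sinh_scaled.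
have [|t] := @MVT_segment _ f df 0 x x0 (fun t _ => dF t).
  apply: continuous_subspaceT => t; apply: differentiable_continuous.
  by apply/derivable1_diffP; exact: (@ex_derive _ _ _ _ _ _ _ (dF t)).
rewrite in_itv /= => /andP[t0 _].
rewrite /f /df !mulr0 sinh0 mulr0 !mul1r !subr0 => E.
rewrite -subr_ge0 E mulr_ge0// -mulrBr mulr_ge0 ?subr_ge0//; first lra.
by apply: ler_cosh => //; nra.
Qed.

Lemma sinh_ge_id x : 0 <= x -> x <= sinh x.
Proof.
move=> x0.
have dF (t : R) : is_derive t 1 (fun t => sinh (1 * t)) (1 * cosh (1 * t)).
  exact: is_derive_sinh_scaled.
have [|t] := @MVT_segment _ _ _ 0 x x0 (fun t _ => dF t).
  apply: continuous_subspaceT => t; apply: differentiable_continuous.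
  by apply/derivable1_diffP; exact: (@ex_derive _ _ _ _ _ _ _ (dF t)).
rewrite mulr0 sinh0 !mul1r !subr0 => _ ->.
by rewrite ler_peMl// cosh_ge1.
Qed.

(** This concavity estimate turns a bound on the arguments of arsinh into the
    same bound on its values. *)
Lemma arsinh_scale_le k y : 1 <= k -> 0 <= y -> arsinh (k * y) <= k * arsinh y.
Proof.
move=> k1 y0; rewrite -ler_sinh arsinhK -{1}(arsinhK y).
by apply: sinh_scale_ge => //; exact: arsinh_ge0.
Qed.

Lemma arsinh_le_id y : 0 <= y -> arsinh y <= y.
Proof. by move=> y0; rewrite -{2}(arsinhK y) sinh_ge_id// arsinh_ge0. Qed.

(** The bounds on e^x and on e^(-x) both come from 1 - x <= e^(-x). *)
Lemma sinh_le_near0 x : 0 <= x -> x < 1 -> sinh x <= x / (1 - x).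
Proof.
move=> x0 x1; have h := expR_ge1Dx (- x); have p : 0 < 1 - x by lra.
have : expR x <= (1 - x)^-1.
  rewrite -[expR x]invrK -expRN lef_pV2 ?posrE ?expR_gt0//.
have : (1 - x) * (1 - x)^-1 = 1 by rewrite divff// lt0r_neq0.
rewrite /sinh; move: h; move: (expR x) (expR (- x)) ((1 - x)^-1) => a b c.
by move=> ? ? ?; nra.
Qed.

Lemma cosh_le_expR x : 0 <= x -> cosh x <= expR x.
Proof.
move=> x0; have : expR (- x) <= expR x by rewrite ler_expR; lra.
by rewrite /cosh; lra.
Qed.

Lemma expR_le_cosh x : expR x <= 2 * cosh x.
Proof. by rewrite /cosh; have := expR_gt0 (- x); lra. Qed.

End hyperbolic_functions.

(** * The hyperbolic distance of the half-space *)

Section half_space.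
Context {R : realType} {n : nat}.
Implicit Types p q r w : 'rV[R]_n.+1.
Notation ht p := (p 0 0).

Definition hdist p q : R := 2 * arsinh (enorm (p - q) / (2 * Num.sqrt (ht p * ht q))).

Lemma hdist_ge0 p q : 0 <= hdist p q.
Proof.
by rewrite mulr_ge0// arsinh_ge0// divr_ge0 ?enorm_ge0// mulr_ge0// sqrtr_ge0.
Qed.

Lemma hdistC p q : hdist p q = hdist q p.
Proof. by rewrite /hdist enorm_distC (mulrC (ht p)). Qed.

Lemma hdistxx p : hdist p p = 0.
Proof. by rewrite /hdist subrr enorm0 mul0r arsinh0 mulr0. Qed.

Lemma hdist_gt0 p q : 0 < ht p -> 0 < ht q -> p <> q -> 0 < hdist p q.
Proof.
move=> p0 q0 pq; rewrite mulr_gt0// arsinh_gt0// divr_gt0//.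
  by apply: enorm_gt0 => /eqP; rewrite subr_eq0 => /eqP.
by rewrite mulr_gt0// sqrtr_gt0 mulr_gt0.
Qed.

Lemma cosh_hdist p q : 0 < ht p -> 0 < ht q ->
  cosh (hdist p q) = 1 + sqnorm (p - q) / (2 * (ht p * ht q)).
Proof.
move=> p0 q0; rewrite cosh_double arsinhK expr_div_n exprMn sqr_enorm.
rewrite sqr_sqrtr ?mulr_ge0 ?ltW//.
by congr (1 + _); field; rewrite !lt0r_neq0.
Qed.

Lemma hdist_le_chord p q : 0 < ht p -> 0 < ht q ->
  hdist p q <= enorm (p - q) / Num.sqrt (ht p * ht q).
Proof.
move=> p0 q0; have s0 : 0 < Num.sqrt (ht p * ht q) by rewrite sqrtr_gt0 mulr_gt0.
apply: le_trans (ler_wpM2l _ (arsinh_le_id _)) _ => //.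
  by rewrite divr_ge0 ?enorm_ge0// mulr_ge0// ltW.
rewrite le_eqVlt; apply/orP; left; apply/eqP.
by field; rewrite lt0r_neq0.
Qed.

(* The space component of p in the hyperboloid model centred at r, in
   half-space coordinates. *)
Let spatial r p := (ht p)^-1 *: (p - r) + (cosh (hdist p r) - 1) *: delta_mx 0 0.

Lemma dotr_spatial p q r : 0 < ht p -> 0 < ht q -> 0 < ht r ->
  dotr (spatial r p) (spatial r q) =
  cosh (hdist p r) * cosh (hdist q r) - cosh (hdist p q).
Proof.
move=> p0 q0 r0; rewrite !cosh_hdist// /spatial !cosh_hdist//.
have -> : p - q = (p - r) - (q - r) by rewrite opprB addrA subrK.
have hp : (p - r) 0 0 = ht p - ht r by rewrite !mxE.
have hq : (q - r) 0 0 = ht q - ht r by rewrite !mxE.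
move: (p - r) (q - r) hp hq => a b ha hb.
rewrite /sqnorm !dotrE !(dotrC (delta_mx 0 0)) !dotr_delta ha hb (dotrC b a).
rewrite !mxE !eqxx /=.
move: (dotr a a) (dotr b b) (dotr a b) => aa bb ab.
by field; rewrite !lt0r_neq0.
Qed.

(** In the hyperboloid model with r as origin, cosh(d(p,q)) is
    cosh(d(p,r)) cosh(d(q,r)) minus the inner product of the space components,
    whose norms are sinh(d(p,r)) and sinh(d(q,r)); the bound is then the
    Cauchy-Schwarz inequality. *)
Lemma hdist_triangle r p q : 0 < ht p -> 0 < ht q -> 0 < ht r ->
  hdist p q <= hdist p r + hdist r q.
Proof.
move=> p0 q0 r0; rewrite (hdistC r q).
apply: cosh_le_inv; first by rewrite addr_ge0// hdist_ge0.
have nrm (x : 'rV[R]_n.+1) : 0 < ht x -> enorm (- spatial r x) = sinh (hdist x r).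
  move=> x0; rewrite enormN enormE /sqnorm dotr_spatial// hdistxx.
  have -> : cosh (0 : R) = 1 by rewrite /cosh oppr0 expR0; lra.
  rewrite -expr2 cosh_sqr addrAC subrr add0r sqrtr_sqr ger0_norm//.
  by rewrite sinh_ge0// hdist_ge0.
have := cauchy_schwarz (- spatial r p) (spatial r q).
rewrite dotrNl dotr_spatial// nrm// -[enorm (spatial r q)]enormN nrm//.
by rewrite coshD opprB lerBlDr addrC.
Qed.

Section geodesic.
Variables p q : 'rV[R]_n.+1.
Hypotheses (p0 : 0 < ht p) (q0 : 0 < ht q) (pq : p <> q).
Let h := hdist p q.

(** On the hyperboloid, the geodesic at time t is the combination of its end
    points with coefficients sinh(h - t)/sinh(h) and sinh(t)/sinh(h), where
    h = d(p,q). The weights below are these coefficients divided by the heights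
    of p and q, since the hyperboloid coordinates of a point of the half-space
    are 1, its tail and its square norm, all divided by its height. Vertical
    lines and half-circles are thus treated alike. *)
Definition geod_weightl t : R := sinh (hdist p q - t) / (ht p * sinh (hdist p q)).
Definition geod_weightr t : R := sinh t / (ht q * sinh (hdist p q)).
Local Notation wl := geod_weightl.
Local Notation wr := geod_weightr.

Definition geodesic t : 'rV[R]_n.+1 :=
  (wl t + wr t)^-1 *: (wl t *: p + wr t *: q +
    (1 - wl t * ht p - wr t * ht q) *: delta_mx 0 0).

Let h0 : 0 < h. Proof. exact: hdist_gt0. Qed.
Let sh0 : 0 < sinh h. Proof. exact: sinh_gt0. Qed.

Lemma geod_weightl_ge0 t : t <= h -> 0 <= wl t.
Proof.
by move=> th; rewrite divr_ge0 ?sinh_ge0 ?subr_ge0// mulr_ge0// ltW.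
Qed.

Lemma geod_weightr_ge0 t : 0 <= t -> 0 <= wr t.
Proof. by move=> t0; rewrite divr_ge0 ?sinh_ge0// mulr_ge0// ltW. Qed.

Lemma geod_weight_gt0 t : 0 <= t <= h -> 0 < wl t + wr t.
Proof.
move=> /andP[]; rewrite le_eqVlt => /predU1P[<- _|t0 th].
  by rewrite ltr_pwDl ?geod_weightr_ge0// /wl subr0 divr_gt0// mulr_gt0.
by rewrite ltr_wpDl ?geod_weightl_ge0// divr_gt0 ?sinh_gt0// mulr_gt0.
Qed.

Lemma geod_head t : 0 <= t <= h -> ht (geodesic t) = (wl t + wr t)^-1.
Proof.
move=> ht_; rewrite /geodesic !mxE !eqxx /=; field.
by rewrite lt0r_neq0// geod_weight_gt0.
Qed.

Lemma geod_tail t : tail (geodesic t) =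
  (wl t + wr t)^-1 *: (wl t *: tail p + wr t *: tail q).
Proof. by rewrite /geodesic tailZ !tailD !tailZ tail_delta scaler0 addr0. Qed.

Lemma geod_start : geodesic 0 = p.
Proof.
have t0 : 0 <= (0 : R) <= h by apply/andP; split => //; exact: ltW.
have wr0 : wr 0 = 0 by rewrite /wr sinh0 mul0r.
have wl0 : wl 0 = (ht p)^-1.
  by rewrite /wl subr0; field; rewrite !lt0r_neq0.
apply: eq_head_tail; first by rewrite geod_head// wr0 wl0 addr0 invrK.
rewrite geod_tail wr0 wl0 scale0r !addr0 scalerA mulVf ?scale1r//.
by rewrite invr_eq0 lt0r_neq0.
Qed.

Lemma geod_end : geodesic h = q.
Proof.
have t0 : 0 <= h <= h by apply/andP; split => //; exact: ltW.
have wl0 : wl h = 0 by rewrite /wl subrr sinh0 mul0r.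
have wr0 : wr h = (ht q)^-1.
  by rewrite /wr -/h; field; rewrite !lt0r_neq0.
apply: eq_head_tail; first by rewrite geod_head// wr0 wl0 add0r invrK.
rewrite geod_tail wr0 wl0 scale0r !add0r scalerA mulVf ?scale1r//.
by rewrite invr_eq0 lt0r_neq0.
Qed.

Let T := sqnorm (tail p - tail q).

Let TE : T = 2 * (ht p * ht q) * cosh h - ht p ^+ 2 - ht q ^+ 2.
Proof.
rewrite cosh_hdist// sqnorm_tail !mxE tailB -/T.
by field; rewrite !lt0r_neq0.
Qed.

Let X_neq : expR h * expR h - 1 != 0.
Proof.
have : 1 < expR h by rewrite expR_gt1.
by move=> X1; rewrite lt0r_neq0// subr_gt0; nra.
Qed.

(** The geodesic is parametrized by hyperbolic length: this is [cosh_hdist] with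
    s - t as hyperbolic distance. *)
Lemma sqnorm_geod_diff s t : 0 <= s <= h -> 0 <= t <= h ->
  sqnorm (geodesic s - geodesic t) =
  2 * (ht (geodesic s) * ht (geodesic t)) * (cosh (s - t) - 1).
Proof.
move=> hs ht_; rewrite sqnorm_tail tailB.
rewrite headB !geod_head// !geod_tail.
have us := lt0r_neq0 (geod_weight_gt0 hs); have ut := lt0r_neq0 (geod_weight_gt0 ht_).
have -> : (wl s + wr s)^-1 *: (wl s *: tail p + wr s *: tail q) -
    (wl t + wr t)^-1 *: (wl t *: tail p + wr t *: tail q) =
    ((wl s * wr t - wl t * wr s) / ((wl s + wr s) * (wl t + wr t))) *:
    (tail p - tail q).
  apply/rowP => i; rewrite !mxE; field; by rewrite us ut.
have -> (k : R) (x : 'rV[R]_n) : sqnorm (k *: x) = k ^+ 2 * sqnorm x.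
  by rewrite /sqnorm !dotrE; ring.
rewrite -/T TE.
suff E : (wl s * wr t - wl t * wr s) ^+ 2 *
    (2 * (ht p * ht q) * cosh h - ht p ^+ 2 - ht q ^+ 2) +
    (wl t + wr t - (wl s + wr s)) ^+ 2 =
    2 * ((wl s + wr s) * (wl t + wr t)) * (cosh (s - t) - 1).
  have := E; move: (wl s) (wr s) (wl t) (wr t) us ut => a b c d us ut E'.
  transitivity (((a * d - c * b) ^+ 2 *
    (2 * (ht p * ht q) * cosh h - ht p ^+ 2 - ht q ^+ 2) +
    (c + d - (a + b)) ^+ 2) / ((a + b) * (c + d)) ^+ 2).
    by field; rewrite us ut.
  by rewrite E'; field; rewrite us ut.
rewrite /geod_weightl /geod_weightr -/h /cosh /sinh !opprB !expRD !expRN.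
have := X_neq; have := expR_gt0 h; have := expR_gt0 s; have := expR_gt0 t.
move: (expR h) (expR s) (expR t) => X S E /lt0r_neq0 E0 /lt0r_neq0 S0 /lt0r_neq0 X0 X1.
by field; rewrite E0 S0 X0 X1 !lt0r_neq0.
Qed.

(** The quotient of the square norm by the height is a hyperboloid coordinate,
    so it is the combination of those of the end points; so is the inverse of
    the height, and the square norm is their quotient. *)
Lemma sqnorm_geod t : 0 <= t <= h ->
  sqnorm (geodesic t) = (wl t * sqnorm p + wr t * sqnorm q) / (wl t + wr t).
Proof.
move=> ht_; rewrite sqnorm_tail geod_head// geod_tail.
have ut := lt0r_neq0 (geod_weight_gt0 ht_).
have E : (wl t * ht p) ^+ 2 + (wr t * ht q) ^+ 2 +
    2 * (wl t * ht p) * (wr t * ht q) * cosh h = 1.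
  rewrite /geod_weightl /geod_weightr -/h /cosh /sinh !opprB !expRD !expRN.
  have := X_neq; have := expR_gt0 h; have := expR_gt0 t.
  move: (expR h) (expR t) => X E /lt0r_neq0 E0 /lt0r_neq0 X0 X1.
  by field; rewrite E0 X0 X1 !lt0r_neq0.
rewrite !(sqnorm_tail p, sqnorm_tail q).
have := TE; rewrite /T.
move: (wl t) (wr t) ut E => a b ut E.
rewrite /sqnorm !dotrE !(dotrC (tail q) (tail p)).
move: (dotr (tail p) (tail p)) (dotr (tail p) (tail q)) (dotr (tail q) (tail q)).
move=> pp pq' qq TE'.
have -> : a * (ht p ^+ 2 + pp) + b * (ht q ^+ 2 + qq) =
   ((a * ht p) ^+ 2 + (b * ht q) ^+ 2 +
    2 * (a * ht p) * (b * ht q) * cosh h +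
    a * (a * pp + b * pq') + b * (a * pq' + b * qq)) / (a + b).
  have : 2 * (ht p * ht q) * cosh h = ht p ^+ 2 + ht q ^+ 2 + (pp - 2 * pq' + qq).
    by lra.
  move=> C; have -> : 2 * (a * ht p) * (b * ht q) * cosh h =
      a * b * (2 * (ht p * ht q) * cosh h) by ring.
  by rewrite C; field.
by rewrite E; field.
Qed.

Lemma enorm_geod_le t (r : R) : 0 <= t <= h ->
  enorm p <= r -> enorm q <= r -> enorm (geodesic t) <= r.
Proof.
move=> ht_ pr qr; have r0 : 0 <= r by apply: le_trans pr; exact: enorm_ge0.
have sq (x : 'rV[R]_n.+1) : (enorm x <= r) = (sqnorm x <= r ^+ 2).
  by rewrite -sqr_enorm ler_pXn2r// nnegrE enorm_ge0.
move: pr qr; rewrite !sq => pr qr.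
rewrite sqnorm_geod// ler_pdivrMr ?geod_weight_gt0//.
case/andP: ht_ => t0 th; rewrite mulrDr lerD//.
- by rewrite mulrC ler_wpM2r// geod_weightl_ge0.
- by rewrite mulrC ler_wpM2r// geod_weightr_ge0.
Qed.

End geodesic.
(** At small parameter distance, the Euclidean speed of the geodesic is at most
    K times its height. *)
Lemma geod_chord_le p q (K M s t : R) :
  0 < ht p -> 0 < ht q -> p <> q -> 1 < K ->
  0 <= s -> s <= t -> t <= hdist p q -> (t - s) / 2 <= 1 - K^-1 ->
  ht (geodesic p q s) <= M -> ht (geodesic p q t) <= M ->
  enorm (geodesic p q t - geodesic p q s) <= M * (K * (t - s)).
Proof.
move=> p0 q0 pq K1 s0 st th tsK sM tM.
have K0 : 0 < K by lra.
have hs : 0 <= s <= hdist p q by apply/andP; split => //; exact: le_trans th.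
have ht_ : 0 <= t <= hdist p q by rewrite th (le_trans s0).
have gs0 : 0 <= ht (geodesic p q s).
  by rewrite geod_head// invr_ge0 ltW// geod_weight_gt0.
have gt0 : 0 <= ht (geodesic p q t).
  by rewrite geod_head// invr_ge0 ltW// geod_weight_gt0.
set d := (t - s) / 2 in tsK.
have d0 : 0 <= d by rewrite divr_ge0// subr_ge0.
have M0 : 0 <= M := le_trans gs0 sM.
apply: le_trans (_ : M * (2 * sinh d) <= _).
  have S0 : 0 <= sinh d := sinh_ge0 d0.
  have MS : 0 <= M * (2 * sinh d) by apply: mulr_ge0 => //; apply: mulr_ge0.
  rewrite -(@ler_pXn2r _ 2) ?nnegrE ?enorm_ge0//.
  rewrite sqr_enorm sqnorm_geod_diff//.
  have -> : t - s = 2 * d by rewrite /d; field.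
  rewrite cosh_double.
  have : ht (geodesic p q t) * ht (geodesic p q s) <= M * M by rewrite ler_pM.
  have := sqr_ge0 (sinh d); nra.
rewrite ler_wpM2l//.
have -> : K * (t - s) = 2 * (K * d) by rewrite /d; field.
rewrite ler_pM2l//.
have Ki : 0 < K^-1 by rewrite invr_gt0.
have d1 : d < 1 by lra.
apply: le_trans (sinh_le_near0 d0 d1) _.
rewrite mulrC ler_wpM2r// -[leRHS]invrK lef_pV2 ?posrE//; lra.
Qed.

(** The height of w is at most its norm, so cosh(d(p,w)) is at least of order
    |w|/p_1. *)
Lemma hdist_far p w (s : R) : 0 < s -> 0 < ht p -> 0 < ht w ->
  enorm p <= s / 2 -> s <= enorm w -> ln (s / (8 * ht p)) <= hdist p w.
Proof.
move=> s0 p0 w0 ps sw.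
rewrite -ler_expR lnK; last by rewrite posrE divr_gt0// mulr_gt0.
apply: le_trans (cosh_le_expR (hdist_ge0 _ _)).
rewrite cosh_hdist//.
have h1 : ht w <= enorm w := head_le_enorm w.
have h2 : enorm w / 2 <= enorm (p - w).
  have := enorm_dist_tri w p 0; rewrite !subr0 enorm_distC; lra.
have w0' : 0 < enorm w by lra.
apply: (@le_trans _ _ (enorm w / (8 * ht p))).
  by rewrite ler_pM2r// invr_gt0 mulr_gt0.
apply: ler_wpDl => //.
rewrite -sqr_enorm ler_pdivlMr ?mulr_gt0//.
have -> : enorm w / (8 * ht p) * (2 * (ht p * ht w)) = enorm w * ht w / 4.
  by field; rewrite lt0r_neq0.
by nra.
Qed.

(** The bounds of [hdist_far] for two points p and q close to 0 add up to at
    least d(p,q), because exp(d(p,q)) <= 2 cosh(d(p,q)) = 2 + |p - q|^2/(p_1 q_1).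
    This is what excludes shortcuts away from 0. *)
Lemma hdist_near p q (s : R) : 0 < s -> 0 < ht p -> 0 < ht q ->
  enorm p <= s / 25 -> enorm q <= s / 25 ->
  hdist p q <= ln (s / (8 * ht p)) + ln (s / (8 * ht q)).
Proof.
move=> s0 p0 q0 ps qs.
have P (x : R) : 0 < x -> 0 < s / (8 * x) by move=> ?; rewrite divr_gt0// mulr_gt0.
have Pp := P _ p0; have Pq := P _ q0.
rewrite -lnM ?posrE// -ler_expR lnK; last by rewrite posrE mulr_gt0.
apply: le_trans (expR_le_cosh _) _; rewrite cosh_hdist//.
have -> : s / (8 * ht p) * (s / (8 * ht q)) = (s ^+ 2 / 64) / (ht p * ht q).
  by field; rewrite !lt0r_neq0.
rewrite ler_pdivlMr ?mulr_gt0//.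
have -> : 2 * (1 + sqnorm (p - q) / (2 * (ht p * ht q))) * (ht p * ht q) =
   2 * (ht p * ht q) + sqnorm (p - q) by field; rewrite !lt0r_neq0.
rewrite -sqr_enorm.
have h1 := head_le_enorm p; have h2 := head_le_enorm q.
have h3 : enorm (p - q) <= 2 * s / 25.
  have := enormD p (- q); rewrite enormN; lra.
have h4 := enorm_ge0 (p - q).
have : ht p * ht q <= (s / 25) * (s / 25).
  by apply: ler_pM; [exact: ltW|exact: ltW|lra|lra].
have : enorm (p - q) ^+ 2 <= (2 * s / 25) ^+ 2 by rewrite ler_pXn2r ?nnegrE//; lra.
by nra.
Qed.

Lemma ln_near_ge0 p (s : R) : 0 < s -> 0 < ht p -> enorm p <= s / 25 ->
  0 <= ln (s / (8 * ht p)).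
Proof.
move=> s0 p0 ps; apply: ln_ge0; rewrite ler_pdivlMr ?mulr_gt0//.
by have := head_le_enorm p; lra.
Qed.

End half_space.

(** * Comparison in a chart *)

Definition truncated_difference (R : realType) (A B a b : R) := Num.min a A - Num.min b B.

(** When a + b >= A + B, one of the two minima is always saturated. *)
Lemma truncated_difference_lip (R : realType) (A B a b a' b' e : R) :
  A + B <= a + b -> A + B <= a' + b' -> `|a - a'| <= e -> `|b - b'| <= e ->
  truncated_difference A B a b - truncated_difference A B a' b' <= e.
Proof.
rewrite /truncated_difference !ler_norml => h h' /andP[? ?] /andP[? ?].
rewrite !minElt.
by case: (ltP a A); case: (ltP b B); case: (ltP a' A); case: (ltP b' B); lra.
Qed.

(** The margin that is enough below is enough above, as 1 - 1/K <= K - 1. *)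
Lemma height_comparable (R : realType) (K z z' : R) : 1 < K -> 0 < z ->
  `|z' - z| <= z * (1 - K^-1) -> z / K <= z' /\ z' <= K * z.
Proof.
move=> K1 z0; have Kk : K * K^-1 = 1 by rewrite divff// gt_eqF// (lt_trans ltr01).
have k0 : 0 < K^-1 by rewrite invr_gt0 (lt_trans ltr01).
have KK : 2 <= K + K^-1 by move: (K^-1) Kk k0 => k; nra.
by move: (K^-1) KK => k KK; rewrite ler_distl => /andP[? ?]; split; nra.
Qed.

Section chart.
Context {R : realType} {n : nat}.
Implicit Types x y z w : 'rV[R]_n.+1.
Notation ht p := (p 0 0).

(** F straightens the boundary of D near u and G inverts it. A single constant K
    measures its distortion of distances and the comparison of the density rho
    with that of the half-space, namely the inverse of the height. *)
Record chart (D : set 'rV[R]_n.+1) (u : 'rV[R]_n.+1) (rho : 'rV[R]_n.+1 -> R)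
  (K r : R) (F G : 'rV[R]_n.+1 -> 'rV[R]_n.+1) : Prop := Chart {
  chart_distortion : 1 < K <= 2;
  chart_radius : 0 < r;
  chart_center : F u = 0;
  chart_lip : forall z w, enorm (z - u) < r -> enorm (w - u) < r ->
    enorm (F z - F w) <= K * enorm (z - w);
  chart_colip : forall z w, enorm (z - u) < r -> enorm (w - u) < r ->
    enorm (z - w) <= K * enorm (F z - F w);
  chart_section : forall w, enorm w < r / 2 ->
    enorm (G w - u) < r /\ F (G w) = w;
  chart_domain : forall z, enorm (z - u) < r -> D z <-> 0 < ht (F z);
  chart_density_ge0 : forall z, D z -> 0 <= rho z;
  chart_density_le : forall z, enorm (z - u) < r -> D z -> rho z <= K / ht (F z);
  chart_density_ge : forall z, enorm (z - u) < r -> D z -> (K * ht (F z))^-1 <= rho z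
}.

Section comparison.
Context {D : set 'rV[R]_n.+1} {u : 'rV[R]_n.+1} {rho : 'rV[R]_n.+1 -> R}
  {K r : R} {F G : 'rV[R]_n.+1 -> 'rV[R]_n.+1}.
Hypothesis cF : chart D u rho K r F G.

Lemma enorm_chart z : enorm (z - u) < r -> enorm (F z) <= 2 * enorm (z - u).
Proof.
move=> zr; have /andP[_ K2] := chart_distortion cF.
have u_r : enorm (u - u) < r by rewrite subrr enorm0 (chart_radius cF).
have := chart_lip cF zr u_r; rewrite (chart_center cF) subr0 => /le_trans; apply.
by rewrite ler_wpM2r// enorm_ge0.
Qed.

Lemma enorm_chart_ge z : enorm (z - u) < r -> enorm (z - u) <= 2 * enorm (F z).
Proof.
move=> zr; have /andP[_ K2] := chart_distortion cF.
have u_r : enorm (u - u) < r by rewrite subrr enorm0 (chart_radius cF).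
have := chart_colip cF zr u_r; rewrite (chart_center cF) subr0 => /le_trans; apply.
by rewrite ler_wpM2r// enorm_ge0.
Qed.


Lemma chartK z : enorm (z - u) < r / 4 -> G (F z) = z.
Proof.
have r0 := chart_radius cF; move=> zr; have zr' : enorm (z - u) < r by lra.
have : enorm (F z) < r / 2 by have := enorm_chart zr'; lra.
case/(chart_section cF) => Gr FG.
have := chart_colip cF Gr zr'; rewrite FG subrr enorm0 mulr0 => h.
apply/eqP; rewrite -subr_eq0; apply/eqP/enorm_eq0/eqP.
by rewrite eq_le h enorm_ge0.
Qed.

(** [potential_le_line_integral] is applied to a potential Phi that is constant
    away from u, where the density is not under control. *)
Lemma hdist_chart_lower x y (a b : R) (g : R -> 'rV[R]_n.+1) : D x -> D y ->
  enorm (x - u) <= r / 200 -> enorm (y - u) <= r / 200 ->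
  rectifiable_path D x y a b g ->
  ((hdist (F x) (F y) / K ^+ 4)%:E <= line_integral rho a b g)%E.
Proof.
have r0 := chart_radius cF; have /andP[K1 K2] := chart_distortion cF.
have K0 : 0 < K := lt_trans ltr01 K1.
move=> Dx Dy xr yr [ab gcont gD [gx gy] fin].
have xr' : enorm (x - u) < r by lra.
have yr' : enorm (y - u) < r by lra.
have p0 : 0 < ht (F x) by apply/(chart_domain cF).
have q0 : 0 < ht (F y) by apply/(chart_domain cF).
pose s := r / 4.
have s0 : 0 < s by rewrite /s; lra.
have ps : enorm (F x) <= s / 25 by have := enorm_chart xr'; rewrite /s; lra.
have qs : enorm (F y) <= s / 25 by have := enorm_chart yr'; rewrite /s; lra.
pose H := hdist (F x) (F y).
have H0 : 0 <= H := hdist_ge0 _ _.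
pose A0 := ln (s / (8 * ht (F x))).
pose B0 := ln (s / (8 * ht (F y))).
have A00 : 0 <= A0 := ln_near_ge0 s0 p0 ps.
have B00 : 0 <= B0 := ln_near_ge0 s0 q0 qs.
have HAB : H <= A0 + B0 := hdist_near s0 p0 q0 ps qs.
(* A and B split H without exceeding the distances to far points *)
pose A := Num.min A0 H.
pose B := H - A.
have [A_0 AA0 AH] : [/\ 0 <= A, A <= A0 & A <= H].
  by rewrite /A le_min A00 H0 !ge_min !lexx orbT.
have BB0 : B <= B0 by rewrite /B /A minElt; case: ltP; lra.
have AB : A + B = H by rewrite /B; lra.
have far z : D z -> r / 2 < enorm (z - u) -> enorm (z - u) < r ->
    A <= hdist (F x) (F z) /\ B <= hdist (F y) (F z).
  move=> Dz z1 z2; have z0 : 0 < ht (F z) by apply/(chart_domain cF).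
  have sz : s <= enorm (F z) by have := enorm_chart_ge z2; rewrite /s; lra.
  split.
    by apply: le_trans AA0 (hdist_far s0 p0 z0 _ sz); lra.
  by apply: le_trans BB0 (hdist_far s0 q0 z0 _ sz); lra.
pose Phi z := if enorm (z - u) < r
  then truncated_difference A B (hdist (F x) (F z)) (hdist (F y) (F z)) else A - B.
have Phi_far z : D z -> r / 2 < enorm (z - u) -> Phi z = A - B.
  move=> Dz z1; rewrite /Phi; case: ifP => // z2.
  have [h1 h2] := far z Dz z1 z2.
  by rewrite /truncated_difference (min_idPr h1) (min_idPr h2).
have -> : H / K ^+ 4 = (Phi (g b)) / K ^+ 4 - (Phi (g a)) / K ^+ 4.
  rewrite -mulrBl gx gy /Phi xr' yr' /truncated_difference !hdistxx.
  rewrite (hdistC (F y)) -/H (min_idPr AH).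
  have BH : B <= H by rewrite /B; lra.
  have B_0 : 0 <= B by rewrite /B; lra.
  by rewrite (min_idPr BH) (min_idPl A_0) (min_idPl B_0) -AB; congr (_ / _); ring.
have gD' t : a <= t <= b -> D (g t).
  by move=> tab; apply: gD; exists t => //=; rewrite in_itv.
apply: (@potential_le_line_integral _ _ rho a b g (fun t => Phi (g t) / K ^+ 4)) => //.
  by move=> t /gD'; exact: (chart_density_ge0 cF).
move/within_continuous_eball : gcont => gc.
move=> t tab; have Dt := gD' t tab.
have [tr|tr] := ltP (enorm (g t - u)) r; last first.
  have [|d d0 dH] := gc t tab (r / 2); first lra.
  exists d => //; exists 0 => // t1 t2 at1 t12 t2b h1 h2.
  have t1ab : a <= t1 <= b by rewrite at1 (le_trans t12).
  have t2ab : a <= t2 <= b by rewrite t2b (le_trans at1).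
  have fart t' : a <= t' <= b -> t - d < t' -> t' < t + d -> Phi (g t') = A - B.
    move=> t'ab h h'; apply: Phi_far; first exact: gD'.
    have := dH t' t'ab h h'; have := enorm_dist_tri (g t) (g t') u.
    by rewrite (enorm_distC (g t) (g t')); lra.
  split; first by apply: (chart_density_ge0 cF); exact: gD'.
  rewrite mul0r (fart t2 t2ab (lt_le_trans h1 t12) h2).
  by rewrite (fart t1 t1ab h1 (le_lt_trans t12 h2)) subrr.
have z0 : 0 < ht (F (g t)) by apply/(chart_domain cF).
set z := ht (F (g t)) in z0.
(* e keeps g in the chart and its height within a factor K of z *)
pose e := Num.min (r - enorm (g t - u)) (z * (1 - K^-1) / K).
have Ki : 0 < 1 - K^-1 by rewrite subr_gt0 invf_lt1.
have [e0 er ez] : [/\ 0 < e, e <= r - enorm (g t - u) & K * e <= z * (1 - K^-1)].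
  have h : e <= z * (1 - K^-1) / K by rewrite ge_min lexx orbT.
  split; last by rewrite mulrC -ler_pdivlMr.
    by rewrite lt_min subr_gt0 tr divr_gt0// mulr_gt0.
  by rewrite ge_min lexx.
have [d d0 dH] := gc t tab e e0.
have near t' : a <= t' <= b -> t - d < t' -> t' < t + d ->
    [/\ D (g t'), enorm (g t' - u) < r, z / K <= ht (F (g t')) & ht (F (g t')) <= K * z].
  move=> t'ab h h'; have := dH t' t'ab h h' => h''.
  have t'r : enorm (g t' - u) < r.
    by have := enorm_dist_tri (g t') (g t) u; lra.
  have : `|ht (F (g t')) - z| <= z * (1 - K^-1).
    apply: le_trans ez; apply: le_trans (_ : K * enorm (g t' - g t) <= _); last first.
      by rewrite ler_pM2l// ltW.
    apply: le_trans (chart_lip cF t'r tr).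
    by rewrite /z -headB; exact: coord_le_enorm.
  by move=> /(height_comparable K1 z0)[? ?]; split => //; exact: gD'.
exists d => //; exists (K * (K * z))^-1.
  by rewrite invr_ge0 mulr_ge0 ?mulr_ge0// ltW.
move=> t1 t2 at1 t12 t2b h1 h2.
have t1ab : a <= t1 <= b by rewrite at1 (le_trans t12).
have t2ab : a <= t2 <= b by rewrite t2b (le_trans at1).
have [D1 r1 z1 z1'] := near t1 t1ab h1 (le_lt_trans t12 h2).
have [D2 r2 z2 z2'] := near t2 t2ab (lt_le_trans h1 t12) h2.
have zK : 0 < z / K by rewrite divr_gt0.
have p1 : 0 < ht (F (g t1)) := lt_le_trans zK z1.
have p2 : 0 < ht (F (g t2)) := lt_le_trans zK z2.
split.
  apply: le_trans (chart_density_ge cF r1 D1).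
  by rewrite lef_pV2 ?posrE ?mulr_gt0// ler_pM2l.
rewrite -mulrBl ler_pdivrMr ?exprn_gt0//.
rewrite /Phi r1 r2.
have hd : hdist (F (g t2)) (F (g t1)) <=
    (K * (K * z))^-1 * enorm (g t2 - g t1) * K ^+ 4.
  apply: le_trans (hdist_le_chord p2 p1) _.
  have : z / K <= Num.sqrt (ht (F (g t2)) * ht (F (g t1))).
    rewrite -[leLHS](gtr0_norm zK) -sqrtr_sqr ler_wsqrtr//.
    by rewrite expr2; apply: ler_pM => //; exact: ltW.
  move=> sq; apply: le_trans (_ : enorm (F (g t2) - F (g t1)) / (z / K) <= _).
    by rewrite ler_wpM2l ?enorm_ge0// lef_pV2// posrE// (lt_le_trans zK).
  apply: le_trans (_ : K * enorm (g t2 - g t1) / (z / K) <= _).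
    by rewrite ler_pM2r ?invr_gt0//; exact: (chart_lip cF).
  rewrite le_eqVlt; apply/orP; left; apply/eqP.
  by field; rewrite !lt0r_neq0.
apply: truncated_difference_lip.
- by rewrite AB (hdistC (F y)); exact: hdist_triangle.
- by rewrite AB (hdistC (F y)); exact: hdist_triangle.
- apply: le_trans hd; rewrite ler_norml.
  have := hdist_triangle p0 p2 p1; have := hdist_triangle p0 p1 p2.
  rewrite (hdistC (F (g t1)) (F (g t2))); lra.
- apply: le_trans hd; rewrite ler_norml.
  have := hdist_triangle q0 p2 p1; have := hdist_triangle q0 p1 p2.
  rewrite (hdistC (F (g t1)) (F (g t2))); lra.
Qed.

(** The path is the preimage of the hyperbolic geodesic. At height z its speed is
    at most K^3 z and the density at most K^2/z, whence K^5. *)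
Lemma chart_path_upper x y : D x -> D y -> x <> y ->
  enorm (x - u) <= r / 16 -> enorm (y - u) <= r / 16 ->
  exists a b (g : R -> 'rV[R]_n.+1), rectifiable_path D x y a b g /\
    (line_integral rho a b g <= (K ^+ 5 * hdist (F x) (F y))%:E)%E.
Proof.
have r0 := chart_radius cF; have /andP[K1 K2] := chart_distortion cF.
have K0 : 0 < K := lt_trans ltr01 K1.
move=> Dx Dy xy xr yr.
have xr' : enorm (x - u) < r by lra.
have yr' : enorm (y - u) < r by lra.
have p0 : 0 < ht (F x) by apply/(chart_domain cF).
have q0 : 0 < ht (F y) by apply/(chart_domain cF).
have pr : enorm (F x) <= r / 8 by have := enorm_chart xr'; lra.
have qr : enorm (F y) <= r / 8 by have := enorm_chart yr'; lra.
have pq : F x <> F y.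
  by move=> E; apply: xy; rewrite -(chartK (z := x)) ?E ?chartK//; lra.
have h0 : 0 < hdist (F x) (F y) := hdist_gt0 p0 q0 pq.
set h := hdist (F x) (F y) in h0.
pose c := geodesic (F x) (F y).
pose g t := G (c t).
have cr t : 0 <= t <= h -> enorm (c t) <= r / 8.
  by move=> th; apply: enorm_geod_le.
have c0 t : 0 <= t <= h -> 0 < ht (c t).
  by move=> th; rewrite geod_head// invr_gt0 geod_weight_gt0.
have gP t : 0 <= t <= h -> enorm (g t - u) < r /\ F (g t) = c t.
  by move=> th; apply: (chart_section cF); have := cr t th; lra.
have gD t : 0 <= t <= h -> D (g t).
  by move=> th; have [gr Fg] := gP t th; apply/(chart_domain cF gr); rewrite Fg c0.
have chord s t M : 0 <= s -> s <= t -> t <= h -> (t - s) / 2 <= 1 - K^-1 ->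
    ht (c s) <= M -> ht (c t) <= M -> enorm (c t - c s) <= M * (K * (t - s)).
  exact: geod_chord_le.
have cM t : 0 <= t <= h -> ht (c t) <= r.
  by move=> th; have := cr t th; have := head_le_enorm (c t); lra.
have gc s t : 0 <= s <= h -> 0 <= t <= h -> enorm (g t - g s) <= K * enorm (c t - c s).
  by move=> /gP[gs <-] /gP[gt <-]; exact: (chart_colip cF).
have Ki : 0 < 1 - K^-1 by rewrite subr_gt0 invf_lt1.
have chord2 s t : 0 <= s <= h -> 0 <= t <= h ->
    s - (1 - K^-1) < t -> t < s + (1 - K^-1) ->
    enorm (c t - c s) <= r * (K * `|t - s|).
  move=> hs ht_ ts st; case/andP: (hs) => s0 sh; case/andP: (ht_) => t0 th.
  have [le_st|lt_ts] := leP s t.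
    by rewrite ger0_norm ?subr_ge0// chord// ?cM//; lra.
  rewrite enorm_distC distrC ger0_norm ?subr_ge0 ?(ltW lt_ts)//.
  by rewrite chord// ?cM ?(ltW lt_ts)//; lra.
have loc t : 0 <= t <= h -> exists2 e : R, 0 < e &
    exists c L : R, [/\ 0 <= c, 0 <= L, c * L <= K ^+ 5 &
    forall t1 t2 : R, 0 <= t1 -> t1 <= t2 -> t2 <= h -> t - e < t1 -> t2 < t + e ->
      rho (g t1) <= c /\ enorm (g t2 - g t1) <= L * (t2 - t1)].
  move=> th; have z0 := c0 t th; set z := ht (c t) in z0.
  pose e := Num.min (1 - K^-1) (z * (1 - K^-1) / (r * K)).
  have rK : 0 < r * K by rewrite mulr_gt0.
  have [e0 e1 ez] : [/\ 0 < e, e <= 1 - K^-1 & r * K * e <= z * (1 - K^-1)].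
    have le : e <= z * (1 - K^-1) / (r * K) by rewrite ge_min lexx orbT.
    split; last by rewrite mulrC -ler_pdivlMr.
      by rewrite lt_min Ki divr_gt0// mulr_gt0.
    by rewrite ge_min lexx.
  have near s : 0 <= s <= h -> t - e < s -> s < t + e ->
      z / K <= ht (c s) /\ ht (c s) <= K * z.
    move=> hs ts st.
    apply: height_comparable => //.
    apply: le_trans ez; apply: le_trans (_ : r * K * `|s - t| <= _); last first.
      by rewrite ler_pM2l// ler_distl; lra.
    rewrite -mulrA; apply: le_trans (chord2 t s th hs _ _); [|lra|lra].
    by rewrite /z -headB; exact: coord_le_enorm.
  (* the factors of the speed: K from the colipschitz bound, K z from the
     height, K from the chord *)
  exists e => //; exists (K / (z / K)), (K * (K * z * K)); split.
  - by rewrite !(divr_ge0, mulr_ge0)// ltW.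
  - by rewrite !mulr_ge0// ltW.
  - rewrite le_eqVlt; apply/orP; left; apply/eqP.
    by field; rewrite !lt0r_neq0.
  move=> t1 t2 t10 t12 t2h h1 h2.
  have t1I : 0 <= t1 <= h by rewrite t10 (le_trans t12).
  have t2I : 0 <= t2 <= h by rewrite t2h (le_trans t10).
  have [n1 n1'] := near t1 t1I h1 (le_lt_trans t12 h2).
  have [n2 n2'] := near t2 t2I (lt_le_trans h1 t12) h2.
  have [gr Fg] := gP t1 t1I.
  split.
    apply: le_trans (chart_density_le cF gr (gD t1 t1I)) _.
    rewrite Fg ler_wpM2l ?(ltW K0)// lef_pV2// posrE ?c0// divr_gt0//.
  apply: le_trans (gc t1 t2 t1I t2I) _.
  rewrite -!mulrA ler_pM2l// !mulrA -(mulrA (K * z)).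
  by apply: chord => //; lra.
have [fin int] := @line_integral_le_of_local _ _ rho (K ^+ 5) 0 h g (ltW h0)
  (exprn_ge0 _ (ltW K0)) (fun t th => chart_density_ge0 cF (gD t th)) loc.
exists 0, h, g; split; last by rewrite subr0 in int.
split => //; first exact: ltW.
- apply/within_continuous_eball => t th e e0.
  have rKK : 0 < r * K * K by rewrite !mulr_gt0.
  exists (Num.min (1 - K^-1) (e / (r * K * K))).
    by rewrite lt_min Ki divr_gt0.
  set d := Num.min _ _ => s hs ts st.
  have d1 : d <= 1 - K^-1 by rewrite ge_min lexx.
  have d2 : d <= e / (r * K * K) by rewrite ge_min lexx orbT.
  apply: le_lt_trans (gc t s th hs) _.
  apply: le_lt_trans (_ : K * (r * (K * `|s - t|)) < _).
    by rewrite ler_pM2l//; apply: chord2 => //; lra.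
  have : `|s - t| < e / (r * K * K).
    by apply: lt_le_trans d2; rewrite ltr_distl; lra.
  rewrite ltr_pdivlMr//; have -> // : `|s - t| * (r * K * K) = K * (r * (K * `|s - t|)).
  by ring.
- by move=> _ [t /= + <-]; rewrite in_itv /= => /gD.
- by rewrite /g /c geod_start// geod_end// !chartK//; lra.
Qed.

End comparison.
End chart.

(** * Straightening a C^1 boundary *)

Section c1_lipschitz.
Context {R : realType} {n : nat}.
Implicit Types (v w d : 'rV[R]_n) (tau : 'rV[R]_n -> R).

Lemma is_derive_line tau w d (t : R) : differentiable tau (w + t *: d) ->
  is_derive t 1 (fun s : R => tau (w + s *: d)) ('D_d tau (w + t *: d)).
Proof.
move=> dtau.
pose f s := tau (w + s *: d).
have E : (fun h : R => h^-1 *: ((f \o shift t) (h *: (1 : R)) - f t)) =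
    (fun h : R => h^-1 *: ((tau \o shift (w + t *: d)) (h *: d) - tau (w + t *: d))).
  apply/funext => h /=; congr (_ *: (tau _ - _)).
  by rewrite scalerDl [h *: 1](mulr1 h) addrCA.
apply: DeriveDef; last by rewrite /derive E.
by rewrite /derivable E; exact: diff_derivable.
Qed.

Lemma derive_partial tau w d : differentiable tau w ->
  'D_d tau w = \sum_i d 0 i * partial i tau w.
Proof.
move=> dtau; rewrite {1}(row_sum_delta d) deriveE// linear_sum.
by apply: eq_bigr => i _; rewrite linearZ /= /partial deriveE.
Qed.

(** Mean value theorem on segments: the partial derivatives are continuous and
    vanish at 0. *)
Lemma C1_small_lipschitz (V : set 'rV[R]_n) tau (e : R) : C1_on V tau -> V 0 ->
  (forall i, partial i tau 0 = 0) -> 0 < e ->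
  exists2 r : R, 0 < r & forall v w, enorm v < r -> enorm w < r ->
    `|tau v - tau w| <= e * enorm (v - w).
Proof.
move=> [oV C1] V0 dt0 e0.
have e0' : 0 < e / n.+1%:R by rewrite divr_gt0.
have : \forall v \near (0 : 'rV[R]_n), V v /\ forall i, `|partial i tau v| <= e / n.+1%:R.
  apply: filterI; first by move: oV; rewrite openE => /(_ _ V0).
  apply: (@filter_forall _ _ (fun i v => `|partial i tau v| <= e / n.+1%:R)
    (nbhs (0 : 'rV[R]_n))) => i.
  have [_ /(_ i)] := C1 _ V0; rewrite /prop_for /continuous_at dt0 => /cvgrPdist_le.
  by move=> /(_ _ e0'); apply: filterS => v; rewrite sub0r normrN.
move=> /nbhs_eball[r r0 Hr]; exists r => // v w vr wr.
have seg t : 0 <= t <= 1 -> enorm (w + t *: (v - w) - 0) < r.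
  move=> /andP[t0 t1]; rewrite subr0.
  have -> : w + t *: (v - w) = (1 - t) *: w + t *: v.
    by apply/rowP => i; rewrite !mxE; ring.
  apply: le_lt_trans (enormD _ _) _; rewrite !enormZ !ger0_norm ?subr_ge0//.
  by have [vw|wv] := leP (enorm v) (enorm w); nra.
pose f s := tau (w + s *: (v - w)).
have dF (t : R) : 0 <= t <= 1 -> is_derive t 1 f ('D_(v - w) tau (w + t *: (v - w))).
  move=> t01; apply: is_derive_line; have [Vt _] := Hr _ (seg t t01).
  by have [] := C1 _ Vt.
have [||c] := @MVT_segment _ f (fun t => 'D_(v - w) tau (w + t *: (v - w))) 0 1 ler01.
- by move=> t; rewrite in_itv /= => /andP[? ?]; apply: dF; rewrite !ltW.
- apply: derivable_within_continuous => t; rewrite in_itv /= => t01.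
  by have [] := dF t t01.
rewrite in_itv /= => c01.
rewrite /f scale0r scale1r addr0 [w + (v - w)]addrC subrK subr0 mulr1 => ->.
have [Vc pc] := Hr _ (seg c c01).
have [dc _] := C1 _ Vc.
rewrite derive_partial//; apply: le_trans (ler_norm_sum _ _ _) _.
apply: (@le_trans _ _ (\sum_(i < n) enorm (v - w) * (e / n.+1%:R))).
  by apply: ler_sum => i _; rewrite normrM ler_pM// coord_le_enorm.
rewrite sumr_const card_ord -[leLHS]mulr_natr -mulrA mulrC.
rewrite ler_wpM2r ?enorm_ge0// -mulrA ler_piMr ?(ltW e0)//.
by rewrite [leLHS]mulrC ler_pdivrMr// mul1r ler_nat.
Qed.
End c1_lipschitz.

Section density.
Context {R : realType} {n : nat}.
Implicit Types (D : set 'rV[R]_n) (u z w xi : 'rV[R]_n).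

Lemma bdist_le D z xi : boundary D xi -> bdist D z <= enorm (z - xi).
Proof.
move=> Dxi; apply: ge_inf; last by exists xi.
by exists 0 => _ [w _ <-]; exact: enorm_ge0.
Qed.

Lemma le_bdist D z u (m : R) : boundary D u ->
  (forall xi, boundary D xi -> m <= enorm (z - xi)) -> m <= bdist D z.
Proof.
move=> Du H; apply: lb_le_inf; first by exists (enorm (z - u)); exists u.
by move=> _ [xi Dxi <-]; exact: H.
Qed.

Lemma bdist_ge0 D z u : boundary D u -> 0 <= bdist D z.
Proof. by move=> Du; apply: (le_bdist Du) => xi _; exact: enorm_ge0. Qed.

Lemma boundary_approx D u (e : R) : boundary D u -> 0 < e ->
  exists2 w, D w & enorm (w - u) < e.
Proof.
move=> [cu _] e0; have [|w [Dw wu]] := cu (fun w => enorm (w - u) < e).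
  by apply/nbhs_eball; exists e.
by exists w.
Qed.

Lemma enorm_le_diam D z w (d : R) : diam D = d%:E -> D z -> D w -> enorm (z - w) <= d.
Proof.
move=> dE Dz Dw; rewrite -lee_fin -dE; apply: ereal_sup_ubound.
by exists (z, w).
Qed.

Lemma boundary_le_diam D z u (d : R) : diam D = d%:E -> boundary D u -> D z ->
  enorm (z - u) <= d.
Proof.
move=> dE Du Dz; apply/ler_addgt0Pr => e e0.
have [w Dw wu] := boundary_approx Du e0.
have := enorm_dist_tri z w u; have := enorm_le_diam dE Dz Dw; lra.
Qed.

Lemma diam_gt0 D u (d : R) : open D -> diam D = d%:E -> boundary D u -> 0 < d.
Proof.
move=> oD dE Du; have [w Dw _] := boundary_approx Du ltr01.
apply: lt_le_trans (boundary_le_diam dE Du Dw).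
apply: enorm_gt0 => /eqP; rewrite subr_eq0 => /eqP wu.
by case: Du => _; apply; rewrite -wu; move: oD; rewrite openE; exact.
Qed.

Lemma m_density_ge0 D u z : open D -> boundary D u -> D z -> 0 <= m_density D z.
Proof.
move=> oD Du Dz; have b0 := bdist_ge0 z Du.
rewrite /m_density; case E : (diam D) => [d| |]; rewrite ?invr_ge0//.
have d0 := diam_gt0 oD E Du.
rewrite divr_ge0 ?(ltW d0)// mulr_ge0// subr_ge0.
exact: le_trans (bdist_le z Du) (boundary_le_diam E Du Dz).
Qed.

(** In the bounded case the density is 1/delta times the factor d/(d - delta),
    which tends to 1 at the boundary. *)
Lemma m_density_near D u (e : R) : open D -> boundary D u -> 0 < e ->
  exists2 r : R, 0 < r & forall z, enorm (z - u) < r -> 0 < bdist D z ->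
    (bdist D z)^-1 <= m_density D z <= (1 + e) / bdist D z.
Proof.
move=> oD Du e0; rewrite /m_density; case E : (diam D) => [d| |].
- have d0 := diam_gt0 oD E Du.
  have e1 : 0 < 1 + e by rewrite addr_gt0.
  exists (e * d / (1 + e)); first by rewrite divr_gt0// mulr_gt0.
  move=> z zu b0; have bz := bdist_le z Du.
  set b := bdist D z in b0 bz *.
  have h : b * (1 + e) < e * d by rewrite -ltr_pdivlMr//; exact: le_lt_trans zu.
  have db : 0 < d - b by nra.
  rewrite /eta -/b invfM mulrA; apply/andP; split.
    rewrite mulrAC ler_peMl ?invr_ge0 ?(ltW b0)//.
    by rewrite ler_pdivlMr// mul1r; lra.
  rewrite mulrAC ler_wpM2r ?invr_ge0 ?(ltW b0)// ler_pdivrMr//; nra.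
- exists 1 => // z _ b0; rewrite lexx /= ler_peMl ?invr_ge0 ?(ltW b0)//; lra.
- exists 1 => // z _ b0; rewrite lexx /= ler_peMl ?invr_ge0 ?(ltW b0)//; lra.
Qed.

(** Both cases of the definition of psi are the half-space formula with the
    inverse of the height replaced by the density. *)
Lemma psiE D u x y : open D -> boundary D u -> D x -> D y ->
  psi D x y =
  2 * arsinh (enorm (x - y) * Num.sqrt (m_density D x * m_density D y) / 2).
Proof.
move=> oD Du Dx Dy; have bx := bdist_ge0 x Du; have b_y := bdist_ge0 y Du.
have base : enorm (x - y) / (2 * Num.sqrt (bdist D x * bdist D y)) =
   enorm (x - y) * Num.sqrt ((bdist D x)^-1 * (bdist D y)^-1) / 2.
  by rewrite -invfM sqrtrV ?mulr_ge0// invfM mulrA mulrAC.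
rewrite /psi /m_density; case E : (diam D) => [d| |]; rewrite ?base//.
have d0 := diam_gt0 oD E Du.
have ge z : D z -> 0 <= eta D d z.
  move=> Dz; rewrite mulr_ge0 ?(bdist_ge0 z Du)// subr_ge0.
  exact: le_trans (bdist_le z Du) (boundary_le_diam E Du Dz).
congr (2 * arsinh _).
rewrite (mulrACA d) -expr2 -invfM (sqrtrM _ (sqr_ge0 d)) sqrtr_sqr gtr0_norm//.
rewrite (sqrtrV (mulr_ge0 (ge _ Dx) (ge _ Dy))).
by rewrite invfM; ring.
Qed.

End density.

Section straightening.
Context {R : realType} {n : nat}.
Implicit Types (D : set 'rV[R]_n.+1) (u x y z w : 'rV[R]_n.+1).
Notation ht p := (p 0 0).
Notation e1 := (delta_mx 0 0 : 'rV[R]_n.+1).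

Lemma dotr_mxE m (x y : 'rV[R]_m) : dotr x y = (x *m y^T) 0 0.
Proof. by rewrite mxE; apply: eq_bigr => i _; rewrite !mxE. Qed.

Lemma rigid_motion_isometry T : rigid_motion T ->
  (forall x y, enorm (T x - T y) = enorm (x - y)) /\
  exists S : 'rV[R]_n.+1 -> 'rV[R]_n.+1, cancel T S /\ cancel S T.
Proof.
move=> [A [b [AAT TE]]]; split.
  move=> x y; rewrite !TE opprD addrACA subrr addr0 -mulmxBl.
  by rewrite !enormE /sqnorm !dotr_mxE trmx_mul mulmxA -(mulmxA _ A) AAT mulmx1.
exists (fun w => (w - b) *m A^T); split=> x; rewrite !TE.
  by rewrite addrK -mulmxA AAT mulmx1.
by rewrite -mulmxA (mulmx1C AAT) mulmx1 subrK.
Qed.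

Lemma enorm_e1 (k : R) : enorm (k *: e1) = `|k|.
Proof.
by rewrite enormZ enormE /sqnorm dotr_delta mxE !eqxx sqrtr1 mulr1.
Qed.

(** A boundary point nearest to z may lie outside the neighbourhood where the
    boundary is a graph only if it is farther from z than u is, so the height of
    F z is at most (1 + e) delta(z). In the other direction, the point of the
    graph below z is at distance exactly the height of F z. *)
Lemma C1_boundary_chart D u (K : R) : domain D -> C1_boundary_point D u ->
  1 < K <= 2 ->
  exists r F G, chart D u (m_density D) K r F G.
Proof.
move=> [_ oD _] [Du [T [U [V [tau [[rT Tu] U0 [C1 UV] [tau0 dtau0] [TD TB]]]]]]].
move=> /andP[K1 K2].
have [isoT [S [TK SK]]] := rigid_motion_isometry rT.
have injT : injective T := can_inj TK.
pose e := (K - 1) / 4.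
have [e0 eK eK' eK2] : [/\ 0 < e, (1 + e) * (1 + e) <= K, 1 <= K * (1 - e) & 1 + e <= K].
  by rewrite /e; split; nra.
have V0 : V 0 by rewrite -(@tail0 R n); apply: UV; exact: nbhs_singleton.
have [rt rt0 lip] := C1_small_lipschitz C1 V0 dtau0 e0.
have [rU rU0 HU] := (iffLR (nbhs_eball _ _)) U0.
have [rd rd0 Hd] := m_density_near oD Du e0.
pose R0 := Num.min rt rU.
have R00 : 0 < R0 by rewrite lt_min rt0.
have Rt : R0 <= rt by rewrite ge_min lexx.
have RU : R0 <= rU by rewrite ge_min lexx orbT.
(* the factor 4 leaves room for the boundary points compared with z *)
pose r := Num.min (R0 / 4) rd.
have r0 : 0 < r by rewrite lt_min divr_gt0.
have r4 : 4 * r <= R0.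
  have : r <= R0 / 4 by rewrite ge_min lexx.
  lra.
have rrd : r <= rd by rewrite ge_min lexx orbT.
clearbody R0 r e.
pose F z := T z + tau (tail (T z)) *: e1.
pose G w := S (w - tau (tail w) *: e1).
have normT z : enorm (T z) = enorm (z - u) by rewrite -isoT Tu subr0.
have tailF w k : tail (w + k *: e1) = tail w.
  by rewrite tailD tailZ tail_delta scaler0 addr0.
have headF z : ht (F z) = ht (T z) + tau (tail (T z)).
  by rewrite /F !mxE !eqxx mulr1.
have headZ k : ht (k *: e1) = k by rewrite !mxE !eqxx mulr1.
have inU z : enorm (z - u) < 4 * r -> U (T z).
  by move=> zu; apply: HU; rewrite subr0 normT; lra.
have lipT z w : enorm (z - u) < 4 * r -> enorm (w - u) < 4 * r ->
    `|tau (tail (T z)) - tau (tail (T w))| <= e * enorm (z - w).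
  move=> zu wu; rewrite -(isoT z w).
  have tl x : enorm (x - u) < 4 * r -> enorm (tail (T x)) < rt.
    by move=> xu; apply: le_lt_trans (enorm_tail_le _) _; rewrite normT; lra.
  apply: le_trans (lip _ _ (tl z zu) (tl w wu)) _.
  by rewrite -tailB ler_pM2l// enorm_tail_le.
have FB z w : F z - F w = (T z - T w) + (tau (tail (T z)) - tau (tail (T w))) *: e1.
  by rewrite /F scalerBl opprD addrACA.
have lipF z w : enorm (z - u) < 4 * r -> enorm (w - u) < 4 * r ->
    enorm (F z - F w) <= (1 + e) * enorm (z - w).
  move=> zu wu; rewrite FB; apply: le_trans (enormD _ _) _.
  by rewrite enorm_e1 isoT mulrDl mul1r lerD2l lipT.
have colipF z w : enorm (z - u) < 4 * r -> enorm (w - u) < 4 * r ->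
    (1 - e) * enorm (z - w) <= enorm (F z - F w).
  move=> zu wu; have := lipT z w zu wu.
  have := enormD (F z - F w) (- ((tau (tail (T z)) - tau (tail (T w))) *: e1)).
  by rewrite enormN enorm_e1 {1}FB addrK isoT; lra.
have Fu : F u = 0 by rewrite /F Tu tail0 tau0 add0r scale0r.
have lipFu z : enorm (z - u) < 4 * r -> enorm (F z) <= (1 + e) * enorm (z - u).
  move=> zu; have := lipF z u zu; rewrite Fu subr0; apply.
  by rewrite subrr enorm0; lra.
have DF z : enorm (z - u) < r -> D z <-> 0 < ht (F z).
  move=> zu; have UTz : U (T z) by apply: inU; lra.
  rewrite headF; split => [Dz|h].
    suff : ((T @` D) `&` U) (T z) by rewrite TD => -[].
    by split => //; exists z.
  have : ((T @` D) `&` U) (T z) by rewrite TD.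
  by move=> [[w Dw /injT <-]].
have BF xi : enorm (xi - u) < 4 * r -> boundary D xi <-> ht (F xi) = 0.
  move=> zu; have UTz : U (T xi) by exact: inU.
  rewrite headF; split => [Dz|h].
    suff : ((T @` boundary D) `&` U) (T xi) by rewrite TB => -[].
    by split => //; exists xi.
  have : ((T @` boundary D) `&` U) (T xi) by rewrite TB.
  by move=> [[w Dw /injT <-]].
have bd_le z : enorm (z - u) < r -> D z -> bdist D z <= ht (F z).
  move=> zu Dz; have z4 : enorm (z - u) < 4 * r by lra.
  have hz : 0 < ht (F z) by apply/DF.
  (* the point of the boundary below z *)
  pose xi := S (T z - ht (F z) *: e1).
  have Txi : T xi = T z - ht (F z) *: e1 by rewrite /xi SK.
  have zxi : enorm (z - xi) = ht (F z).
    by rewrite -isoT Txi opprB addrCA subrr addr0 enorm_e1 gtr0_norm.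
  rewrite -zxi; apply: bdist_le; apply/BF.
    have h1 : ht (F z) <= (1 + e) * enorm (z - u).
      exact: le_trans (head_le_enorm _) (lipFu z z4).
    have := enorm_dist_tri xi z u; rewrite (enorm_distC xi z) zxi.
    by have := enorm_ge0 (z - u); nra.
  rewrite headF.
  have -> : tail (T xi) = tail (T z) by rewrite Txi -scaleNr tailF.
  by rewrite Txi headB headZ headF; ring.
have bd_ge z : enorm (z - u) < r -> D z -> ht (F z) <= (1 + e) * bdist D z.
  move=> zu Dz; have z4 : enorm (z - u) < 4 * r by lra.
  rewrite mulrC -ler_pdivrMr; last lra.
  apply: (le_bdist Du) => xi Dxi; rewrite ler_pdivrMr; last lra.
  rewrite mulrC; have [xi4|xi4] := ltP (enorm (xi - u)) (4 * r).
    apply: le_trans (lipF z xi z4 xi4).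
    rewrite -[leLHS]subr0 -(iffLR (BF xi xi4) Dxi) -headB.
    exact: head_le_enorm.
  apply: (@le_trans _ _ ((1 + e) * enorm (z - u))).
    exact: le_trans (head_le_enorm _) (lipFu z z4).
  rewrite ler_pM2l; last lra.
  have := enorm_dist_tri xi z u; rewrite (enorm_distC xi z); lra.
have bd_gt z : enorm (z - u) < r -> D z -> 0 < bdist D z.
  move=> zu Dz; have := bd_ge z zu Dz; have := iffLR (DF z zu) Dz.
  by nra.
exists r, F, G; split => //.
- by rewrite K1.
- move=> z w zu wu; apply: (@le_trans _ _ ((1 + e) * enorm (z - w))).
    by apply: lipF; lra.
  by rewrite ler_wpM2r// enorm_ge0.
- move=> z w zu wu; apply: (@le_trans _ _ (K * ((1 - e) * enorm (z - w)))).
    by rewrite mulrA ler_peMl// enorm_ge0.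
  by rewrite ler_pM2l ?(lt_trans ltr01)//; apply: colipF; lra.
- move=> w wr; have TG : T (G w) = w - tau (tail w) *: e1 by rewrite /G SK.
  split; last by rewrite /F TG -scaleNr tailF scaleNr subrK.
  rewrite -normT TG; apply: le_lt_trans (enormD _ _) _.
  rewrite enormN enorm_e1.
  have tw : enorm (tail w) < rt.
    by apply: le_lt_trans (enorm_tail_le _) _; lra.
  have := lip _ _ tw (_ : enorm 0 < rt); rewrite enorm0 tau0 !subr0 => /(_ rt0).
  by have := enorm_tail_le w; have := enorm_ge0 w; nra.
- by move=> z; exact: m_density_ge0 oD Du.
- move=> z zu Dz; have b0 := bd_gt z zu Dz; have h0 := iffLR (DF z zu) Dz.
  have /andP[_] := Hd z (lt_le_trans zu rrd) b0 => /le_trans; apply.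
  rewrite ler_pdivrMr// mulrAC ler_pdivlMr//.
  apply: (@le_trans _ _ ((1 + e) * ((1 + e) * bdist D z))).
    by rewrite ler_pM2l; [exact: bd_ge | lra].
  by rewrite mulrA ler_pM2r.
- move=> z zu Dz; have b0 := bd_gt z zu Dz; have h0 := iffLR (DF z zu) Dz.
  have /andP[+ _] := Hd z (lt_le_trans zu rrd) b0; apply: le_trans.
  rewrite lef_pV2 ?posrE ?mulr_gt0//; last lra.
  apply: le_trans (bd_le z zu Dz) _; rewrite ler_peMl//; lra.
Qed.
End straightening.

(** * The limit of the ratio *)

Section conclusion.
Context {R : realType} {n : nat}.
Implicit Types (D : set 'rV[R]_n.+1) (u x y z w : 'rV[R]_n.+1).
Notation ht p := (p 0 0).

(** The arguments of arsinh differ by a factor at most K^2: one K from the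
    distances and one from the geometric mean of the densities. *)
Lemma psi_hdist_comparable D u (K r : R) F G x y :
  open D -> boundary D u -> chart D u (m_density D) K r F G ->
  D x -> D y -> enorm (x - u) < r -> enorm (y - u) < r ->
  psi D x y <= K ^+ 2 * hdist (F x) (F y) /\
  hdist (F x) (F y) <= K ^+ 2 * psi D x y.
Proof.
move=> oD Du cF Dx Dy xr yr.
have /andP[K1 K2] := chart_distortion cF.
have K0 : 0 < K := lt_trans ltr01 K1.
have p0 : 0 < ht (F x) by apply/(chart_domain cF).
have q0 : 0 < ht (F y) by apply/(chart_domain cF).
have hx1 := chart_density_le cF xr Dx; have hx2 := chart_density_ge cF xr Dx.
have hy1 := chart_density_le cF yr Dy; have hy2 := chart_density_ge cF yr Dy.
have ex := chart_density_ge0 cF Dx; have ey := chart_density_ge0 cF Dy.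
have e1 := chart_lip cF xr yr; have e2 := chart_colip cF xr yr.
rewrite (psiE oD Du Dx Dy) /hdist.
have k1 : 1 <= K ^+ 2 by rewrite exprn_ege1// ltW.
set s := Num.sqrt (ht (F x) * ht (F y)).
have s0 : 0 < s by rewrite sqrtr_gt0 mulr_gt0.
set t := Num.sqrt (m_density D x * m_density D y).
have t0 : 0 <= t by exact: sqrtr_ge0.
have st : t <= K / s.
  have -> : K / s = Num.sqrt ((K / ht (F x)) * (K / ht (F y))).
    rewrite mulrACA -expr2 -invfM sqrtrM ?sqr_ge0// sqrtr_sqr gtr0_norm//.
    by rewrite sqrtrV// mulr_ge0// ltW.
  by rewrite ler_wsqrtr// ler_pM.
have ts : (K * s)^-1 <= t.
  have -> : (K * s)^-1 = Num.sqrt ((K * ht (F x))^-1 * (K * ht (F y))^-1).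
    rewrite -invfM mulrACA -expr2 sqrtrV; last first.
      by rewrite mulr_ge0 ?sqr_ge0// mulr_ge0 ?ltW.
    by rewrite sqrtrM ?sqr_ge0// sqrtr_sqr gtr0_norm.
  by rewrite ler_wsqrtr// ler_pM// invr_ge0 mulr_ge0// ltW.
set X := enorm (x - y) * t / 2; set Y := enorm (F x - F y) / (2 * s).
have X0 : 0 <= X by rewrite divr_ge0// mulr_ge0// enorm_ge0.
have Y0 : 0 <= Y by rewrite divr_ge0 ?enorm_ge0// mulr_ge0// ltW.
have XY : X <= K ^+ 2 * Y.
  apply: (@le_trans _ _ (K * enorm (F x - F y) * (K / s) / 2)).
    by rewrite ler_pM2r// ler_pM// enorm_ge0.
  rewrite le_eqVlt; apply/orP; left; apply/eqP; rewrite /Y.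
  by field; rewrite lt0r_neq0.
have YX : Y <= K ^+ 2 * X.
  apply: (@le_trans _ _ (K * enorm (x - y) / (2 * s))).
    by rewrite ler_pM2r// invr_gt0 mulr_gt0.
  have -> : K * enorm (x - y) / (2 * s) = K ^+ 2 * (enorm (x - y) * (K * s)^-1 / 2).
    by field; rewrite !lt0r_neq0.
  by rewrite ler_pM2l ?exprn_gt0// ler_pM2r// ler_wpM2l// enorm_ge0.
rewrite !(mulrCA _ 2) !ler_pM2l//; split.
  by apply: le_trans (arsinh_scale_le k1 Y0); rewrite ler_arsinh.
by apply: le_trans (arsinh_scale_le k1 X0); rewrite ler_arsinh.
Qed.

Lemma expr1D_le (k : nat) (t : R) : 0 <= t <= 1 ->
  (1 + t) ^+ k <= 1 + (2 ^+ k - 1) * t.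
Proof.
move=> /andP[t0 t1]; elim: k => [|k IH]; first by rewrite !expr0; lra.
rewrite !exprS; apply: le_trans (ler_wpM2l _ IH) _; first lra.
have : 1 <= (2 : R) ^+ k by rewrite exprn_ege1// ler1n.
move: (2 ^+ k) => c c1.
have : 0 <= (c - 1) * (t * (1 - t)) by rewrite !mulr_ge0 ?subr_ge0.
by lra.
Qed.

Lemma ratio_close D u (e : R) : domain D -> C1_boundary_point D u -> 0 < e ->
  exists2 d : R, 0 < d & forall x y, D x -> D y -> x <> y ->
    enorm (x - u) < d -> enorm (y - u) < d ->
    exists2 v : R, (m_metric D x y / (psi D x y)%:E)%E = v%:E & `|1 - v| <= e.
Proof.
move=> dD cu e0; have [_ oD _] := dD; have [Du _] := cu.
(* The ratio lies between K^-6 and K^7, and (1 + t)^7 <= 1 + 127 t. *)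
pose t := Num.min 1 e / 128.
have t0 : 0 < t by rewrite divr_gt0// lt_min ltr01.
have [t1 te] : t <= 1 / 128 /\ t <= e / 128.
  by rewrite !ler_pM2r// !ge_min !lexx orbT.
pose K := 1 + t.
have K12 : 1 < K <= 2 by apply/andP; split; rewrite /K; lra.
have [K1 K2] := andP K12.
have K0 : 0 < K := lt_trans ltr01 K1.
have K7 : K ^+ 7 <= 1 + e.
  apply: le_trans (expr1D_le 7 _) _; first by apply/andP; split; lra.
  by rewrite !exprS expr0; lra.
have [r [F [G cF]]] := C1_boundary_chart dD cu K12.
have r0 := chart_radius cF.
exists (r / 200); first by rewrite divr_gt0.
move=> x y Dx Dy xy xr yr.
have xr' : enorm (x - u) < r by lra.
have yr' : enorm (y - u) < r by lra.
have p0 : 0 < ht (F x) by apply/(chart_domain cF).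
have q0 : 0 < ht (F y) by apply/(chart_domain cF).
have pq : F x <> F y.
  by move=> E; apply: xy; rewrite -(chartK cF (z := x)) ?E ?(chartK cF)//; lra.
have H0 : 0 < hdist (F x) (F y) := hdist_gt0 p0 q0 pq.
have [PH HP] := psi_hdist_comparable oD Du cF Dx Dy xr' yr'.
have lo : ((hdist (F x) (F y) / K ^+ 4)%:E <= m_metric D x y)%E.
  apply: le_ereal_inf_tmp => _ [a [b [g [gP ->]]]].
  by apply: (hdist_chart_lower cF Dx Dy _ _ gP); exact: ltW.
have up : (m_metric D x y <= (K ^+ 5 * hdist (F x) (F y))%:E)%E.
  have [||a [b [g [gP gle]]]] := chart_path_upper cF Dx Dy xy; [lra|lra|].
  by apply: le_trans gle; apply: ereal_inf_lbound; exists a, b, g.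
move: lo up PH HP H0; set H := hdist _ _; set P := psi _ _ _.
case: (m_metric D x y) => [a| |] //; rewrite !lee_fin => lo up PH HP H0.
have Kn m : 0 < K ^+ m by rewrite exprn_gt0.
have P0 : 0 < P by rewrite -(pmulr_rgt0 _ (Kn 2)); exact: lt_le_trans HP.
exists (a / P); first by rewrite inver gt_eqF// -EFinM.
have u7 : a / P <= 1 + e.
  rewrite ler_pdivrMr//; apply: le_trans up _.
  apply: (@le_trans _ _ (K ^+ 5 * (K ^+ 2 * P))); first by rewrite ler_pM2l.
  by rewrite mulrA -exprD ler_pM2r.
have l7 : 1 - e <= a / P.
  rewrite ler_pdivlMr//; apply: le_trans lo.
  rewrite ler_pdivlMr//.
  have [e1|e1] := lerP 1 e.
    apply: le_trans (ltW H0).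
    by rewrite -mulrA mulr_le0_ge0 ?subr_le0// mulr_ge0 ?(ltW P0) ?(ltW (Kn _)).
  apply: (@le_trans _ _ (P / K ^+ 2)); last by rewrite ler_pdivrMr// mulrC.
  rewrite ler_pdivlMr//.
  have -> : (1 - e) * P * K ^+ 4 * K ^+ 2 = ((1 - e) * K ^+ 6) * P by ring.
  rewrite -[leRHS]mul1r ler_pM2r//.
  apply: (@le_trans _ _ ((1 - e) * (1 + e))); last by nra.
  rewrite ler_pM2l ?subr_gt0//; apply: le_trans K7.
  by rewrite [leRHS]exprS ler_peMl ?(ltW (Kn _)) ?(ltW K1).
by rewrite ler_distlC; apply/andP; split; lra.
Qed.

End conclusion.

Theorem theorem3p1 (R : realType) (n : nat) (hn : (2 <= n.+1)%N)
  (D : set 'rV[R]_n.+1) (u : 'rV[R]_n.+1)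
  (hD : domain D) (hproper : D <> setT) (hu : C1_boundary_point D u) :
  (fun p : 'rV[R]_n.+1 * 'rV[R]_n.+1 =>
      (m_metric D p.1 p.2 / (psi D p.1 p.2)%:E)%E)
    @ within [set p | D p.1 /\ D p.2 /\ p.1 <> p.2] (nbhs (u, u))
    --> 1%:E.
Proof.
have near_ratio (e : R) : 0 < e ->
    \forall p \near within [set p | D p.1 /\ D p.2 /\ p.1 <> p.2] (nbhs (u, u)),
    exists2 v : R, (m_metric D p.1 p.2 / (psi D p.1 p.2)%:E)%E = v%:E & `|1 - v| <= e.
  move=> e0; have [d d0 H] := ratio_close hD hu e0.
  rewrite near_withinE.
  pose B := [set x : 'rV[R]_n.+1 | enorm (x - u) < d].
  have uB : nbhs u B by apply/nbhs_eball; exists d.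
  exists (B, B) => //.
  by move=> [x y] [/= xd yd] [Dx [Dy xy]]; exact: H.
apply/fine_cvgP; split.
  by apply: filterS (near_ratio _ ltr01) => p [v -> _].
apply/cvgrPdist_le => e e0.
by apply: filterS (near_ratio _ e0) => p [v /= -> ve].
Qed.
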